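(* Let $\mu_0 = \mu_0^u\otimes\mu_0^{\bm{\sigma}}$ be the prior measure, let $\Phi(u,\bm{\sigma};\bm{d}) = \frac12\|\bm{d}-Hu\|_{\Sigma}^2+\frac12\log(\det\Sigma)$ with $\Sigma=\mathrm{diag}(\sigma_1,\ldots,\sigma_{N_d})$, and let $\mu^{\bm{d}}$ be the posterior measure, given by $\frac{d\mu^{\bm{d}}}{d\mu_0}(u,\bm{\sigma}) = \frac{1}{Z_{\bm{d}}}\exp(-\Phi(u,\bm{\sigma};\bm{d}))$. Let $\mathcal{A}_u$ and $\mathcal{A}_{\bm{\sigma}}$ be the sets of probability measures defined in the context. Then the minimization problem $$\operatorname*{arg\,min}_{\nu^u\in\mathcal{A}_u,\ \nu^{\bm{\sigma}}\in\mathcal{A}_{\bm{\sigma}}} D_{\mathrm{KL}}\left(\nu^u\otimes\nu^{\bm{\sigma}}\,||\,\mu^{\bm{d}}\right)$$ possesses a solution $\nu(du,d\bm{\sigma})=\nu^u(du)\,\nu^{\bm{\sigma}}(d\bm{\sigma})$, which satisfies $$\frac{d\nu}{d\mu_0}(u,\bm{\sigma})\propto\exp\left(-\Phi_u(u)-\Phi_{\bm{\sigma}}(\bm{\sigma})\right),$$ where $$\Phi_u(u)=\int_{(\mathbb{R}^+)^{N_d}}\Phi(u,\bm{\sigma};\bm{d})\,\nu^{\bm{\sigma}}(d\bm{\sigma})+\text{Const},\qquad \Phi_{\bm{\sigma}}(\bm{\sigma})=\int_{\mathcal{H}_u}\Phi(u,\bm{\sigma};\bm{d})\,\nu^{u}(du)+\text{Const},$$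 with ''Const'' denoting constants independent of $u$ and $\bm{\sigma}$. Furthermore, $$\nu^u(du)\propto\exp(-\Phi_u(u))\,\mu_0^u(du),\qquad \nu^{\bm{\sigma}}(d\bm{\sigma})\propto\exp(-\Phi_{\bm{\sigma}}(\bm{\sigma}))\,\mu_0^{\bm{\sigma}}(d\bm{\sigma}).$$
   Context: $\mathcal{H}_u$ is a (possibly infinite-dimensional) real separable Hilbert space, $N_d$ is a positive integer, $H:\mathcal{H}_u\to\mathbb{R}^{N_d}$ is a bounded linear operator, and $\bm{d}\in\mathbb{R}^{N_d}$ is given data. The model is $\bm{d}=Hu+\bm{\epsilon}$ with $\bm{\epsilon}\sim\mathcal{N}(0,\Sigma)$, $\Sigma=\mathrm{diag}(\sigma_1,\ldots,\sigma_{N_d})$, $\sigma_i>0$, and $\bm{\sigma}=(\sigma_1,\ldots,\sigma_{N_d})\in(\mathbb{R}^+)^{N_d}$ is treated as unknown. Notation: $\|\cdot\|_{\Sigma}=\|\Sigma^{-1/2}\cdot\|$ (Euclidean norm). Priors: $\mu_0^u=\mathcal{N}(\bar u_0,\mathcal{C}_0)$ is the Gaussian measure on $\mathcal{H}_u$ with mean $\bar u_0\in\mathcal{H}_u$ and symmetric, positive definite, trace class covariance operator $\mathcal{C}_0$. $\mu_0^{\bm{\sigma}}=\prod_{i=1}^{N_d}\mathrm{IG}(\alpha_i^0,\beta_i^0)$ is a product of inverse Gamma distributions with $\alpha_i^0>1$, $\beta_i^0>0$, i.e. with Lebesgue density proportional to $\prod_i\sigma_i^{-\alpha_i^0-1}\exp(-\beta_i^0/\sigma_i)$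 on $(\mathbb{R}^+)^{N_d}$. The constant $Z_{\bm{d}}$ normalizes $\mu^{\bm{d}}$ to be a probability measure. Kullback–Leibler divergence: $D_{\mathrm{KL}}(\nu||\mu)=\int\log\left(\frac{d\nu}{d\mu}\right)\frac{d\nu}{d\mu}\,d\mu$, with $0\log 0=0$. Admissible sets: let $\mathcal{Z}_u$ be a Hilbert space embedded in $\mathcal{H}_u$, and set $T_N^u=\{u : 1/N\le\|u\|_{\mathcal{Z}_u}\le N\}$; it is assumed that $\sup_N\mu_0^u(T_N^u)=1$. Set $T_N^{\bm{\sigma}}=\{\bm{\sigma}: 1/N\le\sigma_i\le N,\ i=1,\ldots,N_d\}$. Let $a(\epsilon,\bm{\sigma})=\sum_{i=1}^{N_d}\max(\sigma_i^{\epsilon},\exp(\epsilon/\sigma_i))$ and let $\epsilon_0>0$ be a fixed number (chosen small relative to $\min_i\{\alpha_i^0,\beta_i^0\}$) such that $\mathbb{E}^{\mu_0^{\bm{\sigma}}}[a(\epsilon,\cdot)]<\infty$ for $\epsilon\in(0,\epsilon_0)$. Define - $R_u^1=\{\Phi_u : \sup_{u\in T_N^u}\Phi_u(u)<\infty\text{ for all }N>0\}$, - $R_u^2=\{\Phi_u : \int_{\mathcal{H}_u}\exp(-\Phi_u(u))\max(1,\|u\|_{\mathcal{H}_u}^2)\,\mu_0^u(du)<\infty\}$, - $R_{\bm{\sigma}}^1=\{\Phi_{\bm{\sigma}} : \sup_{\bm{\sigma}\in T_N^{\bm{\sigma}}}\Phi_{\bm{\sigma}}(\bm{\sigma})<\infty\text{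 for all }N>0\}$, - $R_{\bm{\sigma}}^2=\{\Phi_{\bm{\sigma}} : \int_{(\mathbb{R}^+)^{N_d}}\exp(-\Phi_{\bm{\sigma}}(\bm{\sigma}))\max(1,a(\epsilon,\bm{\sigma}))\,\mu_0^{\bm{\sigma}}(d\bm{\sigma})<\infty\text{ for }\epsilon\in[0,\epsilon_0)\}$. Then $\mathcal{A}_u$ is the set of Borel probability measures $\nu^u$ on $\mathcal{H}_u$ that are equivalent to (mutually absolutely continuous with) $\mu_0^u$, with $\frac{d\nu^u}{d\mu_0^u}(u)=\frac{1}{Z_u}\exp(-\Phi_u(u))$, $Z_u=\mathbb{E}^{\mu_0^u}[\exp(-\Phi_u)]$, for some $\Phi_u\in R_u^1\cap R_u^2$. Likewise $\mathcal{A}_{\bm{\sigma}}$ is the set of Borel probability measures $\nu^{\bm{\sigma}}$ on $(\mathbb{R}^+)^{N_d}$ that are equivalent to $\mu_0^{\bm{\sigma}}$, with $\frac{d\nu^{\bm{\sigma}}}{d\mu_0^{\bm{\sigma}}}(\bm{\sigma})=\frac{1}{Z_{\bm{\sigma}}}\exp(-\Phi_{\bm{\sigma}}(\bm{\sigma}))$, $Z_{\bm{\sigma}}=\mathbb{E}^{\mu_0^{\bm{\sigma}}}[\exp(-\Phi_{\bm{\sigma}})]$, for some $\Phi_{\bm{\sigma}}\in R_{\bm{\sigma}}^1\cap R_{\bm{\sigma}}^2$. *)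

(* Defs.v *)
From HB Require Import structures.
From mathcomp Require Import all_boot all_order all_algebra.
From mathcomp Require Import all_classical all_reals all_analysis.

Set Implicit Arguments.
Unset Strict Implicit.
Unset Printing Implicit Defensive.

Import Order.TTheory GRing.Theory Num.Theory.
Import numFieldNormedType.Exports.

Local Open Scope classical_set_scope.
Local Open Scope ring_scope.

HB.mixin Record isHilbert (R : realType) U of CompleteNormedModule R U := {
  inner : U -> U -> R;
  innerC : forall x y, inner x y = inner y x;
  inner_linearl : forall (a : R) (x y z : U),
    inner (a *: x + y) z = a * inner x z + inner y z;
  inner_norm : forall x, inner x x = `|x| ^+ 2
}.

#[short(type="hilbertType")]
HB.structure Definition Hilbert (R : realType) :=
  {U of isHilbert R U & CompleteNormedModule R U}.

Notation borel U := (g_sigma_algebraType (@open U)).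

Section operators.
Context {R : realType} {U : hilbertType R}.
Implicit Types C : U -> U.

Definition separable := exists2 D : set U, countable D & dense D.

Definition bounded_op {V : normedModType R} (f : V -> U) :=
  exists M : R, forall x, `|f x| <= M * `|x|.

Definition symmetric_op C := forall x y, inner (C x) y = inner x (C y).

Definition posdef_op C := forall x, x != 0 -> 0 < inner (C x) x.

(* The index set D is an arbitrary subset of nat, so that finite-dimensional
   spaces are covered. *)
Definition orthonormal_basis (D : set nat) (e : nat -> U) :=
  (forall i j, D i -> D j -> inner (e i) (e j) = (i == j)%:R) /\
  (forall x, (forall i, D i -> inner x (e i) = 0) -> x = 0).

(* For positive C, where |C| = C; the sum does not depend on the basis. *)
Definition trace_class C :=
  exists (D : set nat) (e : nat -> U), orthonormal_basis D e /\
    (\esum_(k in D) (inner (C (e k)) (e k))%:E < +oo)%E.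

End operators.

Section gaussian.
Context {R : realType}.

(* The law N(m, v) on the line, v being the variance. The library's
   normal_prob, which takes the standard deviation, is not a Dirac mass when
   the latter is zero. *)
Definition normal_law (m v : R) (A : set R) : \bar R :=
  if v == 0 then \d_m A else normal_prob m (Num.sqrt v) A.

Definition gaussian_measure (U : hilbertType R) (m : U) (C : U -> U)
    (mu : probability (borel U) R) :=
  forall (h : U) (A : set R), measurable A ->
    mu [set u | A (inner h u)] = normal_law (inner h m) (inner (C h) h) A.

End gaussian.

Section inverse_gamma.
Context {R : realType}.

(* The inverse Gamma density without its normalizing constant. *)
Definition IG_weight (a b s : R) : R := s `^ (- a - 1) * expR (- b / s).

Definition IG_mass (a b : R) : R :=
  fine (\int[@lebesgue_measure R]_(s in `]0%R, +oo[) (IG_weight a b s)%:E)%E.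

Definition IG_pdf (a b s : R) : R := IG_weight a b s / IG_mass a b.

Definition IG (a b : R) (A : set R) : \bar R :=
  (\int[@lebesgue_measure R]_(s in A `&` `]0%R, +oo[) (IG_pdf a b s)%:E)%E.

Definition is_IG_product n (a b : 'I_n -> R)
    (mu : probability (n.-tuple R) R) :=
  forall A : 'I_n -> set R, (forall i, measurable (A i)) ->
    mu [set s | forall i, A i (tnth s i)] = (\prod_(i < n) IG (a i) (b i) (A i))%E.

(* Measures on the positive orthant are represented by measures on R^n which
   are carried by it. *)
Definition orthant n : set (n.-tuple R) := [set s | forall i, 0 < tnth s i].
Arguments orthant : clear implicits.

End inverse_gamma.
Arguments orthant {R} n.

Section densities.
Context d {T : measurableType d} {R : realType}.
Implicit Types (mu nu : probability T R) (f Phi : T -> R) (D : set T).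

(* With A := ~` D this says in particular that nu is carried by D. *)
Definition has_density D nu mu f :=
  forall A, measurable A -> nu A = (\int[mu]_(x in A `&` D) (f x)%:E)%E.

(* If the integral is infinite, Z^-1 = 0, which no probability nu satisfies. *)
Definition has_potential D nu mu Phi :=
  let Z := fine (\int[mu]_(x in D) (expR (- Phi x))%:E)%E in
  has_density D nu mu (fun x => Z^-1 * expR (- Phi x)).

Definition prop_potential D nu mu Phi :=
  exists2 c : R, 0 < c & has_density D nu mu (fun x => c * expR (- Phi x)).

Definition equivalent_measures nu mu := nu `<< mu /\ mu `<< nu.

(* The library's ln vanishes at 0, hence 0 log 0 = 0. The integral is the
   Radon-Nikodym formula when nu << mu; otherwise the divergence is infinite
   by convention. *)
Definition KL nu mu : \bar R :=
  if `[< nu `<< mu >] then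
    (\int[mu]_x
      (let f := fine (Radon_Nikodym (charge_of_finite_measure nu) mu x) in
       (ln f * f)%:E))%E
  else +oo%E.

End densities.

Section admissible_u.
Context {R : realType} {U Z : hilbertType R}.

(* T_N^u, the space Z being identified with its image under j. *)
Definition TNu (j : Z -> U) (N : nat) : set U :=
  [set j z | z in [set z : Z | N%:R^-1 <= `|z| <= N%:R]].

Definition Ru1 (j : Z -> U) : set (U -> R) :=
  [set Phi | forall N, (0 < N)%N ->
     (ereal_sup [set (Phi u)%:E | u in TNu j N] < +oo)%E].

Definition Ru2 (mu0 : probability (borel U) R) : set (U -> R) :=
  [set Phi | (\int[mu0]_u
     (expR (- Phi u) * Num.max 1 (`|u : U| ^+ 2))%:E < +oo)%E].

Definition Au (j : Z -> U) (mu0 : probability (borel U) R) :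
    set (probability (borel U) R) :=
  [set nu | equivalent_measures nu mu0 /\
     exists Phi : borel U -> R, [/\ measurable_fun setT Phi,
       Ru1 j Phi, Ru2 mu0 Phi & has_potential setT nu mu0 Phi]].

End admissible_u.

Section admissible_sigma.
Context {R : realType} {n : nat}.

Definition TNs (N : nat) : set (n.-tuple R) :=
  [set s | forall i, N%:R^-1 <= tnth s i <= N%:R].

Definition aweight (eps : R) (s : n.-tuple R) : R :=
  \sum_(i < n) Num.max (tnth s i `^ eps) (expR (eps / tnth s i)).

Definition Rs1 : set (n.-tuple R -> R) :=
  [set Phi | forall N, (0 < N)%N ->
     (ereal_sup [set (Phi s)%:E | s in TNs N] < +oo)%E].

Definition Rs2 (eps0 : R) (mu0 : probability (n.-tuple R) R) :
    set (n.-tuple R -> R) :=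
  [set Phi | forall eps, 0 <= eps < eps0 ->
     (\int[mu0]_(s in orthant n)
        (expR (- Phi s) * Num.max 1 (aweight eps s))%:E < +oo)%E].

Definition As (eps0 : R) (mu0 : probability (n.-tuple R) R) :
    set (probability (n.-tuple R) R) :=
  [set nu | equivalent_measures nu mu0 /\
     exists Phi : n.-tuple R -> R, [/\ measurable_fun (orthant n) Phi,
       Rs1 Phi, Rs2 eps0 mu0 Phi & has_potential (orthant n) nu mu0 Phi]].

End admissible_sigma.

Section potential.
Context {R : realType} {n : nat}.

Definition enorm (x : 'cV[R]_n) : R := Num.sqrt (\sum_i x i 0 ^+ 2).

Definition Sigma (s : n.-tuple R) : 'M[R]_n := diag_mx (\row_i tnth s i).

Definition Sigma_invsqrt (s : n.-tuple R) : 'M[R]_n :=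
  diag_mx (\row_i (Num.sqrt (tnth s i))^-1).

Definition Sigma_norm (s : n.-tuple R) (x : 'cV[R]_n) : R :=
  enorm (Sigma_invsqrt s *m x).

Definition potential {U : hilbertType R} (H : U -> 'cV[R]_n) (d : 'cV[R]_n)
    (u : U) (s : n.-tuple R) : R :=
  2^-1 * Sigma_norm s (d - H u) ^+ 2 + 2^-1 * ln (\det (Sigma s)).

End potential.

(* Main.v *)
Require Import Defs.
From HB Require Import structures.
From mathcomp Require Import all_boot all_order all_algebra.
From mathcomp Require Import all_classical all_reals all_analysis.
From mathcomp Require Import measurable_realfun ring lra.

Set Implicit Arguments.
Unset Strict Implicit.
Unset Printing Implicit Defensive.

Import Order.TTheory GRing.Theory Num.Theory.
Import numFieldNormedType.Exports.

Local Open Scope classical_set_scope.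
Local Open Scope ring_scope.

(* The idea. With r_i(u) = (d_i - (Hu)_i)^2, the potential couples u and sigma
   only through the products r_i(u) / sigma_i. Hence the best partner of a
   measure on sigma depends on that measure only through p_i = E[1/sigma_i]: it
   is the tilt of mu_0^u by exp(-1/2 sum_i p_i r_i), with normalising constant
   Z(p). Conversely, for p > 0 the product of the laws
   IG(alpha_i + 1/2, (alpha_i + 1/2) / p_i) has E[1/sigma_i] = p_i. Applying the
   Donsker-Varadhan inequality with the logarithmic density of the product of
   these two measures, in whose integral all terms in E[r_i] cancel, bounds the
   divergence of every admissible pair below by a constant plus
     G(p) = - ln Z(p) + sum_i (beta_i p_i - (alpha_i + 1/2) ln p_i),
   with equality for that product itself. G is continuous and coercive on the
   positive orthant, so it has a minimiser p. There Jensen's inequality for Z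
   together with minimality along each coordinate forces
   (alpha_i + 1/2) / p_i = beta_i + E[r_i] / 2, which is the fixed point
   equation for the two potentials. Admissibility of the minimiser rests on the
   finite second moment of mu_0^u (Parseval and trace class) and, for sigma, on
   the integrability of the weights a(eps, sigma). *)

(** * Densities and the Kullback-Leibler divergence *)

(** A minimising sequence of measures could leave the admissible sets in the limit, since these
    demand an equivalent density whose potential obeys bounds; minimising over the vector p replaces
    such limits by the extreme value theorem on a box. In the lower bound E[r_i] enters with
    coefficient (E[1/sigma_i] - p_i) / 2, so taking for p the mean precision of the competitor
    itself makes it vanish, whatever the competitor does on the Hilbert space: one number per
    observation suffices. The shift 1/2 of the shape is the factor sigma_i^(-1/2) of
    det(Sigma)^(-1/2), and the rate is dictated by E[1/sigma_i] = shape / rate. One device stands in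
    for derivatives: if a ln x <= B (x - 1) for all x > 0, then B = a, because both sides touch at x
    = 1. With Jensen supplying the inequality, it yields both the stationarity of p and the Gamma
    recursion behind shape / rate. At the minimiser the excess of the rate over beta_i is half a
    mean of r_i, hence nonnegative, and the admissibility of the potential on sigma rests on this
    sign. *)

Section density.
Context d (T : measurableType d) (R : realType).
Implicit Types (f g psi : T -> R).

Lemma density_probability (mu : {measure set T -> \bar R}) f :
    measurable_fun setT f -> (forall x, 0 <= f x) ->
    (\int[mu]_x (f x)%:E = 1)%E ->
  exists P : probability T R,
    forall A, measurable A -> P A = (\int[mu]_(x in A) (f x)%:E)%E.
Proof.
move=> mf f0 f1; pose m A := (\int[mu]_(x in A) (f x)%:E)%E.
have m0 : m set0 = 0%E by rewrite /m integral_set0.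
have m_ge0 A : (0 <= m A)%E by apply: integral_ge0 => x _; rewrite lee_fin.
have mS : semi_sigma_additive m.
  move=> F mF tF mUF; rewrite /m ge0_integral_bigcup//.
  - apply: is_cvg_ereal_nneg_natsum_cond => n _ _; exact: m_ge0.
  - by apply/measurable_EFinP; exact: measurable_funTS.
  - by move=> x _; rewrite lee_fin.
pose M : {measure set T -> \bar R} :=
  HB.pack_for {measure set T -> \bar R} m (isMeasure.Build _ _ _ m m0 m_ge0 mS).
pose P : probability T R := HB.pack_for (probability T R) m
  (isMeasure.Build _ _ _ m m0 m_ge0 mS)
  (Measure_isProbability.Build _ _ _ M f1).
by exists P.
Qed.

Section change.
Variables (nu : {finite_measure set T -> \bar R})
          (mu : {sigma_finite_measure set T -> \bar R}).
Variable f : T -> R.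
Hypotheses (mf : measurable_fun setT f) (f0 : forall x, 0 <= f x).
Hypothesis nuE : forall A, measurable A -> nu A = (\int[mu]_(x in A) (f x)%:E)%E.

Lemma density_dominates : nu `<< mu.
Proof.
apply/null_content_dominatesP => A mA muA0; rewrite nuE//.
by apply: null_set_integral => //; apply/measurable_EFinP; exact: measurable_funTS.
Qed.

Lemma density_Radon_Nikodym :
  ae_eq mu setT (Radon_Nikodym (charge_of_finite_measure nu) mu) (EFin \o f).
Proof.
have dom := density_dominates.
apply: integral_ae_eq => //.
- exact: Radon_Nikodym_integrable.
- exact/measurable_EFinP.
- move=> A _ mA; rewrite -Radon_Nikodym_integral//=; exact: nuE.
Qed.

Lemma ge0_integral_density (g : T -> \bar R) : measurable_fun setT g ->
  (forall x, 0 <= g x)%E ->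
  (\int[nu]_x g x = \int[mu]_x (g x * (f x)%:E))%E.
Proof.
move=> mg g0; have dom := density_dominates.
rewrite -(Radon_Nikodym_SigmaFinite.change_of_variables dom g0 measurableT mg).
apply: ae_eq_integral => //.
- apply: emeasurable_funM => //.
  exact: measurable_int (Radon_Nikodym_SigmaFinite.f_integrable dom).
- by apply: emeasurable_funM => //; exact/measurable_EFinP.
(* Two derivatives meet here, the one of the change of variables and the one of [nu] as a charge;
   almost everywhere both are [f]. *)
- apply: ae_eqe_mul2l.
  have := ae_eq_Radon_Nikodym_SigmaFinite dom measurableT.
  by move=> /ae_eq_trans; apply; exact: density_Radon_Nikodym.
Qed.

Lemma integrable_density g : measurable_fun setT g ->
  nu.-integrable setT (EFin \o g) <->
  mu.-integrable setT (EFin \o (fun x => g x * f x)).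
Proof.
move=> mg.
have E : (\int[nu]_x `|(g x)%:E| = \int[mu]_x `|(g x * f x)%:E|)%E.
  rewrite ge0_integral_density//; last first.
    by apply/measurable_EFinP; apply: measurableT_comp.
  apply: eq_integral => x _; rewrite EFinM abseM.
  by rewrite (gee0_abs (_ : 0 <= (f x)%:E)%E)// lee_fin.
split=> /integrableP[_ h]; apply/integrableP; split.
- by apply/measurable_EFinP; exact: measurable_funM.
- by rewrite /= -E.
- exact/measurable_EFinP.
- by rewrite /= E.
Qed.

Lemma integral_density g : nu.-integrable setT (EFin \o g) ->
  (\int[nu]_x (g x)%:E = \int[mu]_x (g x * f x)%:E)%E.
Proof.
move=> ig; have mg : measurable_fun setT g.
  by apply/measurable_EFinP; exact: measurable_int ig.
rewrite -(Radon_Nikodym_change_of_variables density_dominates measurableT ig).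
apply: ae_eq_integral => //.
- apply: emeasurable_funM => //; first exact/measurable_EFinP.
  apply: (measurable_int mu).
  by apply: Radon_Nikodym_integrable; exact: density_dominates.
- by apply/measurable_EFinP; exact: measurable_funM.
- have := ae_eqe_mul2l (EFin \o g) density_Radon_Nikodym.
  by apply: filterS => x /[apply].
Qed.

End change.

Section KL.
Variables (nu mu : probability T R).

(** With the density written as an exponential, its logarithm is [psi] itself and no zero set has to
    be discussed. *)
Lemma KL_density psi : measurable_fun setT psi ->
    (forall A, measurable A -> nu A = (\int[mu]_(x in A) (expR (psi x))%:E)%E) ->
    nu.-integrable setT (EFin \o psi) ->
  KL nu mu = (\int[nu]_x (psi x)%:E)%E.
Proof.
move=> mpsi nuE ipsi.
have me : measurable_fun setT (fun x => expR (psi x)) by apply: measurableT_comp.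
have dom := density_dominates me nuE.
rewrite /KL asboolT// (integral_density me nuE ipsi).
apply: ae_eq_integral => //.
- have mh : measurable_fun setT
      (fun x => fine (Radon_Nikodym (charge_of_finite_measure nu) mu x)).
    exact: measurableT_comp.
  by apply/measurable_EFinP; apply: measurable_funM => //; exact: measurableT_comp.
- by apply/measurable_EFinP; exact: measurable_funM.
- have := density_Radon_Nikodym me nuE.
  by apply: filterS => x /[apply] -> /=; rewrite expRK.
Qed.

(* Donsker-Varadhan: pointwise, f ln f >= f psi + f - exp psi for f >= 0. *)
Lemma KL_ge psi : measurable_fun setT psi ->
    nu.-integrable setT (EFin \o psi) ->
    (\int[mu]_x (expR (psi x))%:E <= 1)%E ->
  (\int[nu]_x (psi x)%:E <= KL nu mu)%E.
Proof.
move=> mpsi ipsi e1; rewrite /KL; case: asboolP => dom; last by rewrite leey.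
pose h := fun x => fine (Radon_Nikodym (charge_of_finite_measure nu) mu x).
have mh : measurable_fun setT h by exact: measurableT_comp.
have hE x : (h x)%:E = Radon_Nikodym (charge_of_finite_measure nu) mu x.
  by rewrite /h fineK//; exact: Radon_Nikodym_fin_num.
(* The derivative of a charge carries no sign, so nonnegativity is borrowed from the derivative of
   [nu] as a measure, almost everywhere only. *)
have h0 : \forall x \ae mu, 0 <= h x.
  have := ae_eq_Radon_Nikodym_SigmaFinite dom measurableT.
  apply: filterS => x /(_ I) hx; rewrite -lee_fin hE -hx.
  exact: Radon_Nikodym_SigmaFinite.f_ge0.
have ih : mu.-integrable setT (EFin \o h).
  have : mu.-integrable setT (Radon_Nikodym (charge_of_finite_measure nu) mu).
    exact: Radon_Nikodym_integrable.
  apply: eq_integrable => // x _.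
  exact/esym/hE.
have ihpsi : mu.-integrable setT (fun x => (psi x * h x)%:E).
  have : (\int[mu]_x (`|psi x|%:E * Radon_Nikodym_SigmaFinite.f nu mu x) < +oo)%E.
    rewrite Radon_Nikodym_SigmaFinite.change_of_variables//.
    - by move/integrableP: ipsi => [].
    - by apply/measurable_EFinP; exact: measurableT_comp.
  move=> lty; apply/integrableP; split.
    by apply/measurable_EFinP; exact: measurable_funM.
  apply: le_lt_trans lty; rewrite le_eqVlt; apply/orP; left; apply/eqP.
  apply: ae_eq_integral => //.
  - by apply/measurable_EFinP; apply: measurableT_comp => //; exact: measurable_funM.
  - apply: emeasurable_funM; first by apply/measurable_EFinP; exact: measurableT_comp.
    exact: measurable_int (Radon_Nikodym_SigmaFinite.f_integrable dom).
  - have := ae_eq_Radon_Nikodym_SigmaFinite dom measurableT.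
    move: h0; apply: filterS2 => x h0 /(_ I) hx _ /=.
    by rewrite hx -hE normrM EFinM (ger0_norm h0).
have ie : mu.-integrable setT (fun x => (expR (psi x))%:E).
  apply/integrableP; split.
    by apply/measurable_EFinP; apply: measurableT_comp.
  under eq_integral do rewrite gee0_abs ?lee_fin ?expR_ge0//.
  by rewrite (le_lt_trans e1)// ltry.
pose l x := psi x * h x + (h x - expR (psi x)).
have il : mu.-integrable setT (EFin \o l).
  have -> : EFin \o l = ((fun x => (psi x * h x)%:E) \+
      ((EFin \o h) \- (fun x => (expR (psi x))%:E)))%E.
    by apply/funext.
  by apply: integrableD => //; exact: integrableB.
(* The difference of the two integrals is 1 minus the integral of [expR psi], which is nonnegative
   by assumption. *)
have leint : (\int[nu]_x (psi x)%:E <= \int[mu]_x (l x)%:E)%E.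
  have -> : (\int[mu]_x (l x)%:E = \int[mu]_x (psi x * h x)%:E +
      (\int[mu]_x (h x)%:E - \int[mu]_x (expR (psi x))%:E))%E.
    rewrite -[X in (_ + X)%E](integralB measurableT ih ie).
    by rewrite -(integralD measurableT ihpsi (integrableB measurableT ih ie)).
  have -> : (\int[mu]_x (h x)%:E = 1)%E.
    rewrite -(probability_setT nu) -[RHS]/(charge_of_finite_measure nu setT).
    rewrite (Radon_Nikodym_integral (nu := charge_of_finite_measure nu) dom)//.
    by apply: eq_integral => x _; exact: hE.
  have <- : (\int[nu]_x (psi x)%:E = \int[mu]_x (psi x * h x)%:E)%E.
    rewrite -(Radon_Nikodym_change_of_variables dom)//.
    by apply: eq_integral => x _; rewrite EFinM hE.
  by rewrite leeDl// sube_ge0// ?integrable_fin_num.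
apply: (le_trans leint).
have mk : measurable_fun setT (fun x => ln (h x) * h x).
  by apply: measurable_funM => //; exact: measurableT_comp.
have lk : \forall x \ae mu, l x <= ln (h x) * h x.
  move: h0; apply: filterS => x; rewrite le_eqVlt => /predU1P[hx0|hx].
    by rewrite /l -hx0 !mulr0 !add0r oppr_le0 expR_ge0.
  rewrite /l -subr_ge0.
  (* The inequality 1 + y <= exp y at y = psi - ln h, to be multiplied by h > 0. *)
  have := expR_ge1Dx (psi x - ln (h x)); rewrite expRB lnK//.
  rewrite ler_pdivlMr//; lra.
(* The function h ln h may fail to be integrable, so positive and negative parts are compared
   separately. *)
rewrite integralE [leRHS]integralE leeB//.
- apply: ae_ge0_le_integral => //.
  + by apply: measurable_funepos; exact: measurable_int il.
  + by apply: measurable_funepos; exact/measurable_EFinP.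
  + move: lk; apply: filterS => x lx _; rewrite !funeposE.
    by rewrite ge_max !le_max /= lee_fin lx lexx orbT.
- apply: ae_ge0_le_integral => //.
  + by apply: measurable_funeneg; exact/measurable_EFinP.
  + by apply: measurable_funeneg; exact: measurable_int il.
  + move: lk; apply: filterS => x lx _; rewrite !funenegE.
    by rewrite ge_max !le_max /= lee_fin lerN2 lx lexx orbT.
Qed.

End KL.
End density.

(** * Hilbert spaces *)

Section hilbert.
Context {R : realType} {U : hilbertType R}.
Implicit Types x y z : U.

Lemma innerDl x y z : inner (x + y) z = inner x z + inner y z.
Proof. by rewrite -[X in X + y]scale1r inner_linearl mul1r. Qed.

Lemma inner0l z : inner 0 z = 0 :> R.
Proof.
have /eqP := innerDl 0 0 z; rewrite addr0 -[X in X == _]addr0.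
by rewrite (inj_eq (addrI _)) => /eqP.
Qed.

Lemma innerZl (a : R) x z : inner (a *: x) z = a * inner x z.
Proof. by rewrite -[_ *: x]addr0 inner_linearl inner0l addr0. Qed.

Lemma innerBl x y z : inner (x - y) z = inner x z - inner y z.
Proof. by rewrite -[- y]scaleN1r innerDl innerZl mulN1r. Qed.

Lemma inner_suml (I : Type) (s : seq I) (F : I -> U) z :
  inner (\sum_(i <- s) F i) z = \sum_(i <- s) inner (F i) z.
Proof.
elim: s => [|i s IH]; first by rewrite !big_nil inner0l.
by rewrite !big_cons innerDl IH.
Qed.

Lemma inner_polarization x y :
  inner x y = (`|x + y| ^+ 2 - `|x - y| ^+ 2) / 4.
Proof.
rewrite -!inner_norm innerBl innerDl (innerC x (x + y)) (innerC y (x + y)).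
rewrite (innerC x (x - y)) (innerC y (x - y)) !innerBl !innerDl (innerC y x).
lra.
Qed.

(** Polarization reduces this to the continuity of the norm. *)
Lemma continuous_innerl y : continuous (fun x : U => inner x y : R).
Proof.
rewrite (_ : (fun x => _) =
  (fun x : U => (`|x + y| * `|x + y| - `|x - y| * `|x - y|) / 4 : R)); last first.
  by apply/funext => x; rewrite inner_polarization !expr2.
have cD (z : U) : continuous (fun x : U => `|x + z| : R).
  by move=> x; apply: cvg_norm; apply: cvgD; [exact: cvg_id|exact: cvg_cst].
move=> x; apply: cvgM; last exact: cvg_cst.
by apply: cvgB; apply: cvgM; exact: cD.
Qed.

Lemma measurable_continuous_borel (f : U -> R) :
  continuous f -> measurable_fun [set: borel U] (f : borel U -> R).
Proof.
move=> /continuousP cf; apply: (measurability _ (RGenOpens.measurableE R)).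
by move=> _ [_ [a [b ->] <-]]; rewrite setTI; apply: sub_sigma_algebra; exact/cf/interval_open.
Qed.

(** The vectors need not be normalised: the family is going to be an orthonormal one padded with
    zero vectors. *)
Lemma norm_sqr_sum_orthogonal (e : nat -> U) (c : nat -> R) m n :
    (forall i j, i != j -> inner (e i) (e j) = 0 :> R) ->
  `|\sum_(m <= k < n) c k *: e k| ^+ 2 =
  \sum_(m <= k < n) c k ^+ 2 * inner (e k) (e k).
Proof.
move=> oe; rewrite -inner_norm inner_suml; apply: eq_big_nat => i /andP[mi ni].
rewrite innerZl innerC inner_suml.
rewrite (bigD1_seq i) ?iota_uniq ?mem_index_iota ?mi//=.
rewrite innerZl big1 ?addr0 ?mulrA -?expr2// => j ji.
by rewrite innerZl oe ?mulr0.
Qed.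

(** If the sum is infinite there is nothing to prove. If it is finite, the expansion along [e],
    padded by zeros off [D], is a Cauchy series; its limit has the same coefficients as [x], so
    totality identifies the two, and the norms of the partial sums converge. *)
Lemma Parseval_le (D : set nat) (e : nat -> U) x : orthonormal_basis D e ->
  ((`|x| ^+ 2)%:E <= \sum_(k <oo | k \in D) (inner x (e k) ^+ 2)%:E)%E.
Proof.
move=> [oe be].
pose f k := if k \in D then e k else 0.
have of_ i j : i != j -> inner (f i) (f j) = 0 :> R.
  move=> ij; rewrite /f; case: ifPn => [/set_mem Di|_]; last by rewrite inner0l.
  case: ifPn => [/set_mem Dj|_]; last by rewrite innerC inner0l.
  by rewrite oe// (negbTE ij).
have ff1 i : inner x (f i) ^+ 2 * inner (f i) (f i) = inner x (f i) ^+ 2.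
  rewrite /f; case: ifPn => [/set_mem Di|_]; last by rewrite inner0l innerC inner0l mulr0 expr0n.
  by rewrite oe// eqxx mulr1.
have -> : (\sum_(k <oo | k \in D) (inner x (e k) ^+ 2)%:E = \sum_(k <oo) (inner x (f k) ^+ 2)%:E)%E.
  rewrite [LHS]eseries_mkcond; apply: eq_eseriesr => k _; rewrite /f.
  by case: ifP => // _; rewrite innerC inner0l expr0n.
set S := (X in (_ <= X)%E).
have [Soo|Sfin] := eqVneq S +oo%E; first by rewrite Soo leey.
have S0 : (0 <= S)%E by apply: nneseries_ge0 => k _ _; rewrite lee_fin sqr_ge0.
have Sf : S \is a fin_num by rewrite ge0_fin_numE ?ltey.
pose c k := inner x (f k) : R.
have cf i : c i ^+ 2 * (inner (f i) (f i) : R) = c i ^+ 2 := ff1 i.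
have c0 k : 0 <= c k ^+ 2 by exact: sqr_ge0.
have cS m n : \sum_(m <= k < n) c k ^+ 2 <= fine S.
  rewrite -lee_fin fineK//.
  apply: (@le_trans _ _ (\sum_(0 <= k < n) (c k ^+ 2)%:E)%E).
    rewrite -sumEFin; have [mn|nm] := leqP m n.
      by rewrite [leRHS](@big_cat_nat _ _ _ m 0 n)//= leeDr// sume_ge0// => k _; rewrite lee_fin.
    by rewrite big_geq ?(ltnW nm)// sume_ge0// => k _; rewrite lee_fin.
  by apply: nneseries_lim_ge => k _ _; rewrite lee_fin.
have cc : cvgn (series (fun k => c k ^+ 2)).
  apply: nondecreasing_is_cvgn.
    by apply/nondecreasing_seqP => n; rewrite /series/= big_nat_recr//= lerDl.
  by exists (fine S) => _ [n _ <-]; exact: cS.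
have sc : cvgn (series (fun k => c k *: f k)).
  apply/cauchy_cvgP/cauchy_seriesP => r r0.
  move/cauchy_cvgP/cauchy_seriesP: cc => /(_ (r ^+ 2) (exprn_gt0 2 r0)).
  apply: filterS => -[m n]/=; rewrite ger0_norm ?sumr_ge0// => lt_r.
  rewrite -(@ltr_pXn2r _ 2) ?nnegrE// ?(ltW r0)//.
  rewrite (norm_sqr_sum_orthogonal c)// (le_lt_trans _ lt_r)//.
  by rewrite (eq_bigr _ (fun k _ => cf k)).
pose y := limn (series (fun k => c k *: f k)).
have yx : x = y.
  apply/eqP; rewrite -subr_eq0; apply/eqP; apply: be => i Di.
  rewrite innerBl; apply/eqP; rewrite subr_eq0; apply/eqP/esym.
  have cvy : inner (series (fun k => c k *: f k) n) (e i) @[n --> \oo] --> (inner y (e i) : R).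
    exact: (continuous_cvg _ (@continuous_innerl (e i) y) sc).
  apply: cvg_unique cvy _; first exact: Rhausdorff.
  apply: cvg_near_cst; exists i.+1 => // n /= ni.
  rewrite /series/= inner_suml (bigD1_seq i) ?iota_uniq ?mem_index_iota//=.
  have -> : e i = f i by rewrite /f mem_set.
  rewrite innerZl big1 ?addr0 => [|j ji]; last by rewrite innerZl of_ ?mulr0.
  by rewrite /c /f mem_set// oe// eqxx mulr1.
have cvn : `|series (fun k => c k *: f k) n| ^+ 2 @[n --> \oo] --> `|x| ^+ 2.
  rewrite yx; under eq_fun do rewrite expr2; rewrite expr2.
  by apply: cvgM; exact: cvg_norm.
rewrite -[S]fineK//.
rewrite lee_fin -(cvg_lim (@Rhausdorff R) cvn).
apply: limr_le; first exact: cvgP cvn.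
apply: nearW => n; rewrite /series/= (norm_sqr_sum_orthogonal c)//.
by rewrite (eq_bigr _ (fun k _ => cf k)).
Qed.

End hilbert.

(** * Second moment of a Gaussian measure *)

Lemma ge0_integral_law d d' (T : measurableType d) (T' : measurableType d')
    (R : realType) (P : {measure set T -> \bar R}) (Q : {measure set T' -> \bar R})
    (X : T -> T') (g : T' -> \bar R) :
    measurable_fun setT X -> measurable_fun setT g -> (forall x, 0 <= g x)%E ->
    (forall A, measurable A -> P (X @^-1` A) = Q A) ->
  (\int[P]_t g (X t) = \int[Q]_x g x)%E.
Proof.
move=> mX mg g0 PQ.
rewrite -[LHS](@ge0_integral_pushforward _ _ _ _ _ X mX P setT g)//.
by apply: eq_measure_integral => A mA _; exact: PQ.
Qed.

Section gaussian_moment.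
Context {R : realType}.

(* x^2 exp(-x^2/2) is dominated by a multiple of exp(-x^2/4). *)
Lemma sqr_normal_pdf_le (m s x : R) : 0 < s ->
  (x - m) ^+ 2 * normal_pdf m s x <=
  4 * Num.sqrt 2 * s ^+ 2 * normal_pdf m (Num.sqrt 2 * s) x.
Proof.
move=> s0; have t0 : 0 < Num.sqrt 2 * s by rewrite mulr_gt0// sqrtr_gt0.
rewrite !normal_pdfE ?gt_eqF//.
set y := (x - m) ^+ 2.
have y0 : 0 <= y by exact: sqr_ge0.
(* In the constant of the bound, [Num.sqrt 2] is this ratio of peaks, and 4 s^2 comes from y = 4 s^2
   z below, where half of the exponential pays for z through z exp(-z) <= 1. *)
have -> : normal_peak s = Num.sqrt 2 * normal_peak (Num.sqrt 2 * s).
  rewrite /normal_peak exprMn sqr_sqrtr// -!mulrA -(mulrnAr 2) sqrtrM// invfM.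
  by rewrite mulVKf// gt_eqF// sqrtr_gt0.
rewrite /normal_fun exprMn sqr_sqrtr//.
have p0 : 0 <= normal_peak (Num.sqrt 2 * s) by exact: normal_peak_ge0.
have -> : - (x - m) ^+ 2 / (s ^+ 2 *+ 2) =
   - y / (2 * s ^+ 2 *+ 2) + - (y / (2 * s ^+ 2 *+ 2)).
  rewrite /y; field; lra.
set z := y / (2 * s ^+ 2 *+ 2); rewrite mulNr -/z expRD.
have s2 : 0 < s ^+ 2 by rewrite exprn_gt0.
have z0 : 0 <= z by rewrite divr_ge0// mulrn_wge0// mulr_ge0// ltW.
have -> : y = 4 * s ^+ 2 * z by rewrite /z; field; lra.
have ez : z * expR (- z) <= 1.
  rewrite expRN ler_pdivrMr ?expR_gt0// mul1r.
  by rewrite (le_trans _ (expR_ge1Dx z))// lerDr.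
have e0 : 0 <= expR (- z) by exact: expR_ge0.
rewrite [leLHS](_ : _ = (4 * Num.sqrt 2 * s ^+ 2 * (normal_peak (Num.sqrt 2 * s) * expR (- z)))
   * (z * expR (- z))); last by ring.
by rewrite ler_piMr// !mulr_ge0// ltW.
Qed.

(** The exact value is [v]. A fixed multiple of it is enough for the trace bound, and follows by
    comparison with a wider normal density of mass 1. *)
Lemma normal_law_second_moment (d : measure_display) (T : measurableType d)
    (P : probability T R) (X : T -> R) (m v : R) :
    measurable_fun setT X -> 0 <= v ->
    (forall A, measurable A -> P (X @^-1` A) = normal_law m v A) ->
  (\int[P]_t ((X t - m) ^+ 2)%:E <= (4 * Num.sqrt 2 * v)%:E)%E.
Proof.
move=> mX v0 XE.
(* normal_prob lives on measurableTypeR R, whose display is not that of R. *)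
pose Y : T -> measurableTypeR R := X.
have mY : measurable_fun setT Y by [].
pose g (x : measurableTypeR R) := ((x - m) ^+ 2)%:E.
have mg : measurable_fun setT g.
  rewrite -[measurable_fun _ _]/(measurable_fun [set: R] (g : R -> \bar R)).
  apply/measurable_EFinP; apply: measurable_funX; exact: measurable_funB.
have g0 x : (0 <= g x)%E by rewrite lee_fin sqr_ge0.
rewrite -[leLHS]/(\int[P]_t g (Y t))%E.
move: v0; rewrite le_eqVlt => /predU1P[v0|v0].
  rewrite (@ge0_integral_law _ _ T (measurableTypeR R) R P
    (dirac (m : measurableTypeR R)) Y g)//; last first.
    move=> A mA; transitivity (normal_law m v A); first exact: XE.
    by rewrite /normal_law -v0 eqxx.
  by rewrite integral_dirac// diracT mul1e /g subrr expr0n/= -v0 mulr0.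
have s0 : 0 < Num.sqrt v by rewrite sqrtr_gt0.
rewrite (@ge0_integral_law _ _ T (measurableTypeR R) R P
  (normal_prob m (Num.sqrt v)) Y g)//; last first.
  move=> A mA; transitivity (normal_law m v A); first exact: XE.
  by rewrite /normal_law gt_eqF.
rewrite (@ge0_integral_density _ _ _ (normal_prob m (Num.sqrt v)) lebesgue_measure
  (normal_pdf m (Num.sqrt v)))//; last exact: measurable_normal_pdf.
set s := Num.sqrt v in s0 *.
rewrite -(sqr_sqrtr (ltW v0)) -/s.
apply: (@le_trans _ _ (\int[lebesgue_measure]_x
  ((4 * Num.sqrt 2 * s ^+ 2)%:E * (normal_pdf m (Num.sqrt 2 * s) x)%:E))%E).
  apply: ge0_le_integral => //=.
  - by move=> x _; rewrite mule_ge0// lee_fin normal_pdf_ge0.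
  - by apply: emeasurable_funM => //; apply/measurable_EFinP; exact: measurable_normal_pdf.
  - by apply: emeasurable_funM => //; apply/measurable_EFinP; exact: measurable_normal_pdf.
  - by move=> x _; rewrite -!EFinM lee_fin sqr_normal_pdf_le.
rewrite ge0_integralZl//=.
- by rewrite integral_normal_pdf mule1.
- by apply/measurable_EFinP; exact: measurable_normal_pdf.
- by move=> x _; rewrite lee_fin normal_pdf_ge0.
- by rewrite lee_fin !mulr_ge0 ?sqrtr_ge0 ?sqr_ge0.
Qed.

(** The k-th coordinate of u - m is normal with variance <C e_k, e_k>; summing the one-dimensional
    bounds gives a multiple of the trace. *)
Lemma gaussian_second_moment (U : hilbertType R) (m : U) (C : {linear U -> U})
    (mu : probability (borel U) R) :
    posdef_op C -> trace_class C -> gaussian_measure m C mu ->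
  (\int[mu]_u (`|u : U| ^+ 2)%:E < +oo)%E.
Proof.
move=> pC [D [e [be trC]]] gmu.
have C0 h : 0 <= inner (C h) h.
  have [->|h0] := eqVneq h 0; first by rewrite innerC inner0l.
  exact/ltW/pC.
have minn (f : U -> R) : continuous f -> measurable_fun [set: borel U]
  (EFin \o f : borel U -> \bar R).
  by move=> cf; apply/measurable_EFinP; exact: measurable_continuous_borel.
have cn2m : continuous (fun u : U => `|u - m| ^+ 2 : R).
  move=> u; apply: (@continuous_comp _ _ _ (fun u : U => `|u - m|) (fun x : R => x ^+ 2)).
    by apply: cvg_norm; apply: cvgB; [exact: cvg_id|exact: cvg_cst].
  exact: exprn_continuous.
have cn2 : continuous (fun u : U => `|u| ^+ 2 : R).
  move=> u; apply: (@continuous_comp _ _ _ (fun u : U => `|u|) (fun x : R => x ^+ 2)).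
    exact: norm_continuous.
  exact: exprn_continuous.
have mk h : measurable_fun [set: borel U] (fun u : borel U => inner (u - m : U) h : R).
  apply: measurable_continuous_borel => u.
  apply: (@continuous_comp U U R (fun u => u - m) (fun u => inner u h)).
    by apply: cvgB; [exact: cvg_id|exact: cvg_cst].
  exact: continuous_innerl.
have mk2 h : measurable_fun [set: borel U]
  (fun u : borel U => (inner (u - m : U) h ^+ 2)%:E : \bar R).
  by apply/measurable_EFinP; apply: measurable_funX; exact: mk.
pose K : R := 4 * Num.sqrt 2.
have K0 : 0 <= K by rewrite mulr_ge0.
have moment h : (\int[mu]_u (inner (u - m : U) h ^+ 2)%:E <= (K * inner (C h) h)%:E)%E.
  have -> : (\int[mu]_u (inner (u - m : U) h ^+ 2)%:E =
      \int[mu]_u ((inner h (u : U) - inner h m) ^+ 2)%:E)%E.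
    by apply: eq_integral => u _; rewrite innerBl !(innerC _ h).
  apply: normal_law_second_moment => //.
    have -> : inner h = (fun u : U => inner u h) by apply/funext => u; rewrite innerC.
    by apply: measurable_continuous_borel; exact: continuous_innerl.
  by move=> A mA; rewrite -gmu.
have trC' : (\sum_(k <oo) (if k \in D then (inner (C (e k)) (e k))%:E else 0) < +oo)%E.
  move: trC; rewrite esum_mkcond -nneseries_esumT// => k.
  by case: ifP => // _; rewrite lee_fin.
have centered : (\int[mu]_u (`|u - m : U| ^+ 2)%:E < +oo)%E.
  apply: (@le_lt_trans _ _ (\int[mu]_u \sum_(k <oo)
      if k \in D then (inner (u - m : U) (e k) ^+ 2)%:E else 0)%E).
    apply: ge0_le_integral => //=.
    - by apply: (minn (fun u => `|u - m| ^+ 2)); exact: cn2m.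
    - apply: (ge0_emeasurable_sum (P := xpredT)) => [k u _ _|k _].
        by case: ifP => // _; rewrite lee_fin sqr_ge0.
      by case: (k \in D) => //; exact: mk2.
    - by move=> u _; rewrite -eseries_mkcond; exact: Parseval_le.
  rewrite integral_nneseries//; last 2 first.
  - by move=> k; case: (k \in D) => //; exact: mk2.
  - by move=> k u _; case: ifP => // _; rewrite lee_fin sqr_ge0.
  apply: (@le_lt_trans _ _ (\sum_(k <oo)
      K%:E * if k \in D then (inner (C (e k)) (e k))%:E else 0)%E).
    apply: lee_nneseries => [k _ _|k _].
      by apply: integral_ge0 => u _; case: ifP => // _; rewrite lee_fin sqr_ge0.
    case: ifP => _; last by rewrite integral0 mule0.
    by rewrite -EFinM; exact: moment.
  rewrite nneseriesZl => [|k _]; last by case: ifP => // _; rewrite lee_fin.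
  by rewrite lte_mul_pinfty.
(* Back from the centred moment, by |u|^2 <= 2 |u - m|^2 + 2 |m|^2. *)
apply: (@le_lt_trans _ _ (\int[mu]_u (2%:E * (`|u - m : U| ^+ 2)%:E + (2 * `|m| ^+ 2)%:E))%E).
  apply: ge0_le_integral => //=.
  - by apply: (minn (fun u => `|u| ^+ 2)); exact: cn2.
  - apply: emeasurable_funD => //; apply: emeasurable_funM => //.
    by apply: (minn (fun u => `|u - m| ^+ 2)); exact: cn2m.
  - move=> u _; rewrite -EFinM -EFinD lee_fin.
    have tri : `|u : U| <= `|u - m : U| + `|m|.
      by rewrite -{1}(subrK m u) ler_normD.
    apply: (@le_trans _ _ ((`|u - m : U| + `|m|) ^+ 2)).
      by rewrite ler_pXn2r ?nnegrE ?addr_ge0.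
    have := sqr_ge0 (`|u - m : U| - `|m|); lra.
rewrite ge0_integralD//=; last first.
  apply: emeasurable_funM => //.
  by apply: (minn (fun u => `|u - m| ^+ 2)); exact: cn2m.
rewrite ge0_integralZl//=; last first.
  by apply: (minn (fun u => `|u - m| ^+ 2)); exact: cn2m.
rewrite lte_add_pinfty// ?lte_mul_pinfty//.
by rewrite integral_cst//= (probability_setT mu) mule1 ltry.
Qed.

End gaussian_moment.

(** * Inverse Gamma integrals *)

Lemma gt0_integral0_null d (T : measurableType d) (R : realType)
    (mu : {measure set T -> \bar R}) (D : set T) (f : T -> R) :
    measurable D -> measurable_fun D f -> (forall x, D x -> 0 < f x) ->
  (\int[mu]_(x in D) (f x)%:E = 0 -> mu D = 0)%E.
Proof.
move=> mD mf f0 if0.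
have mf' : measurable_fun D (EFin \o f) by exact/measurable_EFinP.
have : ae_eq mu D (EFin \o f) (cst 0%E).
  apply/ae_eq_integral_abs => //; rewrite -if0; apply: eq_integral => x /[!inE] Dx.
  by rewrite gee0_abs// lee_fin ltW// f0.
move=> [N [mN N0 subN]]; apply/eqP; rewrite -measure_le0 -N0 le_measure ?inE//.
move=> x Dx; apply: subN => /= /(_ Dx)/eqP.
by rewrite eqe gt_eqF// f0.
Qed.

(** Serves Jensen's inequality: [f] will be a tangent, which may be negative, and [g] an exponential
    whose integral is not known to be finite. *)
Lemma le_sub_integral d (T : measurableType d) (R : realType)
    (mu : {measure set T -> \bar R}) (D : set T) (f g : T -> \bar R) :
    measurable D -> mu.-integrable D f -> measurable_fun D g ->
    (forall x, D x -> 0 <= g x)%E -> (forall x, D x -> f x <= g x)%E ->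
  (\int[mu]_(x in D) f x <= \int[mu]_(x in D) g x)%E.
Proof.
move=> mD fi mg g0 fg.
rewrite integralE (le_trans (_ : _ <= \int[mu]_(x in D) f^\+ x)%E)//.
  rewrite leeBlDr ?integrable_neg_fin_num// leeDl// integral_ge0//.
apply: ge0_le_integral => //.
- by apply: measurable_funepos; exact: measurable_int fi.
- by move=> x Dx; rewrite funeposE ge_max g0// fg.
Qed.

(* Jensen's inequality, from expR (m - X) >= 1 + (m - X). *)
Lemma integral_expRN_ge d (T : measurableType d) (R : realType)
    (mu : {measure set T -> \bar R}) (D : set T) (w X : T -> R) (A m : R) :
    measurable D -> (forall x, D x -> 0 <= w x) -> measurable_fun D X ->
    mu.-integrable D (EFin \o w) ->
    mu.-integrable D (EFin \o (fun x => w x * X x)) ->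
    (\int[mu]_(x in D) (w x)%:E = A%:E)%E ->
    (\int[mu]_(x in D) (w x * X x)%:E = (A * m)%:E)%E ->
  ((A * expR (- m))%:E <= \int[mu]_(x in D) (w x * expR (- X x))%:E)%E.
Proof.
move=> mD w0 mX iw iwX Aw AX.
have mw : measurable_fun D w by apply/measurable_EFinP; exact: measurable_int iw.
pose l := (fun x => (expR (- m) * (1 + m))%:E * (w x)%:E +
  (- expR (- m))%:E * (w x * X x)%:E)%E.
have il1 := integrableZl mD (expR (- m) * (1 + m)) iw.
have il2 := integrableZl mD (- expR (- m)) iwX.
have -> : (A * expR (- m))%:E = (\int[mu]_(x in D) l x)%E.
  rewrite integralD// !integralZl// Aw AX -!EFinM -EFinD; congr EFin; ring.
apply: le_sub_integral => //.
- exact: integrableD.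
- apply/measurable_EFinP; apply: measurable_funM => //.
  by apply: measurableT_comp => //; exact: measurableT_comp.
- by move=> x Dx; rewrite lee_fin mulr_ge0 ?expR_ge0 ?w0.
- move=> x Dx; rewrite /l -!EFinM -EFinD lee_fin.
  rewrite [leLHS](_ : _ = w x * (expR (- m) * (1 + (m - X x)))); last by ring.
  rewrite ler_wpM2l ?w0//.
  rewrite [Y in _ <= expR Y](_ : _ = - m + (m - X x)); last by ring.
  by rewrite expRD ler_wpM2l ?expR_ge0 ?expR_ge1Dx.
Qed.

(** Both sides vanish at x = 1, so their slopes there must agree. The proof tests x = a / B, where
    the hypothesis reads 1 / x <= 1 - ln x; since 1 / x = exp(- ln x), strictness of exp y > 1 + y
    for y != 0 forces x = 1. *)
Lemma ln_tangent_slope (R : realType) (a B : R) : 0 < a -> 0 < B ->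
  (forall x, 0 < x -> a * ln x <= B * (x - 1)) -> B = a.
Proof.
move=> a0 B0 /(_ (a / B) (divr_gt0 a0 B0)).
rewrite mulrBr mulr1 (mulrCA B) divff ?gt_eqF// mulr1 => h.
have h2 : a * (ln (a / B) - 1 + B / a) <= 0.
  by rewrite mulrDr mulrBr mulr1 (mulrCA a) divff ?gt_eqF//; lra.
have {h}h2 : ln (a / B) - 1 + B / a <= 0 by rewrite pmulr_rle0 in h2.
apply/eqP; apply: contraPT h2 => Ba; apply/negP; rewrite -ltNge.
have BaE : B / a = expR (- ln (a / B)).
  by rewrite -lnV ?posrE ?divr_gt0// invf_div lnK// posrE divr_gt0.
rewrite BaE.
have : - ln (a / B) != 0.
  rewrite oppr_eq0 ln_eq0 ?divr_gt0//.
  by apply: contraNneq Ba => /divr1_eq ->.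
by move=> /expR_gt1Dx; lra.
Qed.

Section scaling.
Context {R : realType}.

(** Multiplied by c, the image of Lebesgue measure under x -> c x gives each half-open interval its
    length, hence is Lebesgue measure. *)
Lemma lebesgue_integral_scale (c : R) (g : R -> \bar R) : 0 < c ->
    measurable_fun setT g -> (forall x, 0 <= g x)%E ->
  (\int[lebesgue_measure]_x g x = c%:E * \int[lebesgue_measure]_x g (c * x)%R)%E.
Proof.
move=> c0 mg g0.
pose phi : measurableTypeR R -> measurableTypeR R := fun x => c * x.
have mphi : measurable_fun setT phi.
  by rewrite -[measurable_fun _ _]/(measurable_fun [set: R] (fun x : R => c * x));
      exact: measurable_funM.
pose Q0 : {measure set (measurableTypeR R) -> \bar R} :=
  mscale (NngNum (ltW c0)) (pushforward lebesgue_measure phi).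
pose Q := Q0 mphi.
have QE A : measurable A -> lebesgue_measure A = Q A.
  apply: lebesgue_measure_unique => _ [[a b] _ <-] /=.
  rewrite /Q /Q0 /mscale/= /pushforward.
  have -> : phi @^-1` `]a, b] = `]a / c, b / c]%classic.
    apply/seteqP; split => x; rewrite /phi /= !in_itv/= ltr_pdivrMr// ler_pdivlMr//;
      by rewrite mulrC.
  rewrite !lebesgue_measure_itv/= !lte_fin ltr_pM2r ?invr_gt0//.
  case: ifPn => _; last by rewrite mule0.
  by rewrite -!EFinB -EFinM; congr EFin; field; rewrite gt_eqF.
rewrite (eq_measure_integral Q) => [|A mA _]; last exact: QE.
by rewrite ge0_integral_mscale// ge0_integral_pushforward.
Qed.

End scaling.

Section inverse_gamma_integral.
Context {R : realType}.
Implicit Types (a b s : R).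

(** Off 0 the inverse is x / x^2, and 1 / x^2 is the exponential of - ln x^2; the factor x also
    produces the value 0 at 0. *)
Lemma measurable_inv : measurable_fun [set: R] (fun x : R => x^-1).
Proof.
have -> : (fun x : R => x^-1) = (fun x => x * expR (- ln (x ^+ 2))).
  apply/funext => x; have [->|x0] := eqVneq x 0; first by rewrite invr0 mul0r.
  rewrite expRN lnK ?posrE ?exprn_even_gt0//.
  by field.
apply: measurable_funM => //; apply: measurableT_comp => //.
by apply: measurableT_comp => //; apply: measurableT_comp => //; exact: measurable_ln.
Qed.

(** The constant is ((k + 1) / c)^k. Factor t as (k + 1) / c times c t / (k + 1) and use ln y < y on
    the second factor; this costs k / (k + 1) times c t. Taking k + 1 rather than k keeps k = 0
    inside the same formula. *)
Lemma powR_le_expR (k c : R) : 0 <= k -> 0 < c ->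
  exists2 C, 0 <= C & forall t, 0 < t -> t `^ k <= C * expR (c * t).
Proof.
move=> k0 c0; exists (expR (k * ln ((k + 1) / c))); first exact: expR_ge0.
move=> t t0; have k1 : 0 < k + 1 by lra.
rewrite -expRD /powR gt_eqF// ler_expR.
have tE : t = (k + 1) / c * (t * c / (k + 1)) by field; rewrite !gt_eqF.
rewrite {1}tE lnM ?posrE ?divr_gt0 ?mulr_gt0// mulrDr lerD2l.
have h := ln_sublinear (divr_gt0 (mulr_gt0 t0 c0) k1).
apply: (@le_trans _ _ (k * (t * c / (k + 1)))); first by rewrite ler_wpM2l// ltW.
rewrite mulrA ler_pdivrMr// (mulrC c) (mulrC k) ler_wpM2l ?mulr_ge0 ?ltW//; lra.
Qed.

Lemma measurable_IG_weight a b : measurable_fun [set: R] (IG_weight a b).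
Proof.
apply: measurable_funM; first exact: measurable_powR.
apply: measurableT_comp => //; apply: measurable_funM => //.
exact: measurable_inv.
Qed.

Lemma IG_weight_ge0 a b s : 0 <= IG_weight a b s.
Proof. by rewrite mulr_ge0 ?powR_ge0 ?expR_ge0. Qed.

Lemma IG_weight_gt0 a b s : 0 < s -> 0 < IG_weight a b s.
Proof. by move=> s0; rewrite mulr_gt0 ?powR_gt0 ?expR_gt0. Qed.

(** Conjugacy of the inverse Gamma family, through which integrals over a single variance reduce to
    [IG_integral]. *)
Lemma IG_weightM a b k c s : 0 < s ->
  s `^ k * expR (- c / s) * IG_weight a b s = IG_weight (a - k) (b + c) s.
Proof.
move=> s0; rewrite /IG_weight mulrACA -expRD -powRD; last by rewrite (gt_eqF s0) implybT.
by congr (_ `^ _ * expR _); [ring|rewrite -mulrDl opprD addrC].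
Qed.

(** The value Gamma(a) / b^a, kept in the extended reals until finiteness is known; [IG_mass] is its
    [fine] part. *)
Definition IG_integral a b : \bar R :=
  (\int[@lebesgue_measure R]_(s in `]0%R, +oo[) (IG_weight a b s)%:E)%E.

Lemma IG_integral_ge0 a b : (0 <= IG_integral a b)%E.
Proof. by apply: integral_ge0 => s _; rewrite lee_fin IG_weight_ge0. Qed.

Lemma IG_integral_neq0 a b : IG_integral a b != 0%E.
Proof.
apply/eqP => I0.
have : @lebesgue_measure R `]0, +oo[%classic = 0%E.
  apply: gt0_integral0_null I0 => //.
    by apply: measurable_funTS; exact: measurable_IG_weight.
  by move=> s; rewrite /= in_itv/= andbT => s0; exact: IG_weight_gt0.
by rewrite lebesgue_measure_itv/= ltry.
Qed.

Lemma IG_integral_scale a b : 0 < b ->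
  IG_integral a b = ((b `^ (- a))%:E * IG_integral a 1)%E.
Proof.
move=> b0; rewrite /IG_integral integral_mkcond [in RHS]integral_mkcond.
pose w c : R -> \bar R := (fun s : R => (IG_weight a c s)%:E) \_ `]0, +oo[.
have mw c : measurable_fun [set: R] (w c).
  apply/(measurable_restrictT _ _).1 => //.
  by apply/measurable_EFinP; apply: measurable_funTS; exact: measurable_IG_weight.
have w0 c s : (0 <= w c s)%E.
  by rewrite /w patchE; case: ifP => // _; rewrite lee_fin IG_weight_ge0.
rewrite (lebesgue_integral_scale (g := w b) b0)// -/(w 1).
rewrite -!ge0_integralZl//; last 4 first.
- rewrite -[measurable_fun _ _]/(measurable_fun [set: R] (w b \o (fun x : R => b * x))).
  by apply: measurableT_comp; [exact: mw|exact: measurable_funM].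
- by rewrite lee_fin ltW.
- exact: mw.
- by rewrite lee_fin powR_ge0.
apply: eq_integral => s _; rewrite /w !patchE !mem_setE !in_itv/= !andbT pmulr_rgt0//.
case: ifPn => [s0|_]; last by rewrite !mule0.
rewrite -!EFinM; congr EFin; rewrite /IG_weight powRM ?ltW//.
have -> : b * (b `^ (- a - 1) * s `^ (- a - 1) * expR (- b / (b * s))) =
  (b * b `^ (- a - 1)) * (s `^ (- a - 1) * expR (- b / (b * s))) by ring.
congr (_ * (_ * expR _)); last by field; rewrite !gt_eqF.
rewrite -{1}(powRr1 (ltW b0)) -powRD; last by rewrite (gt_eqF b0) implybT.
by congr (_ `^ _); ring.
Qed.

(** By scaling, finiteness does not depend on the rate. A larger shape multiplies the weight by s^(a
    - a'), which half of the exponential exp(- b' / s) absorbs by [powR_le_expR] at t = 1 / s. *)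
Lemma IG_integral_fin a b a' b' : 0 < b -> 0 < b' -> a <= a' ->
  (IG_integral a b < +oo -> IG_integral a' b' < +oo)%E.
Proof.
move=> b0 b'0 aa' h.
have h2 c : 0 < c -> (IG_integral a c < +oo)%E.
  move=> c0; rewrite IG_integral_scale// lte_mul_pinfty ?lee_fin ?powR_ge0//.
  have b1 : (b `^ (- a))%:E != 0%E by rewrite eqe gt_eqF// powR_gt0.
  move: h; rewrite IG_integral_scale//.
  have := IG_integral_ge0 a 1; case: (IG_integral a 1) => [r _ _|_|//]; first by rewrite ltry.
  by rewrite gt0_muley ?lte_fin ?powR_gt0// ltxx.
have c0 : 0 < b' / 2 by rewrite divr_gt0.
have [|C C0 CE] := @powR_le_expR (a' - a) (b' / 2) _ c0; first lra.
apply: (@le_lt_trans _ _ (C%:E * IG_integral a (b' / 2))%E); last first.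
  by rewrite lte_mul_pinfty ?h2.
rewrite -ge0_integralZl//; last 2 first.
- by apply/measurable_EFinP; apply: measurable_funTS; exact: measurable_IG_weight.
- by move=> s _; rewrite lee_fin IG_weight_ge0.
apply: ge0_le_integral => //.
- by move=> s _; rewrite lee_fin IG_weight_ge0.
- by apply/measurable_EFinP; apply: measurable_funTS; exact: measurable_IG_weight.
- apply: emeasurable_funM => //.
  by apply/measurable_EFinP; apply: measurable_funTS; exact: measurable_IG_weight.
- move=> s; rewrite /= in_itv/= andbT => s0.
  rewrite -EFinM lee_fin.
  have -> : IG_weight a' b' s = s `^ (- (a' - a)) * expR (- (b' / 2) / s) * IG_weight a (b' / 2) s.
    rewrite IG_weightM//; congr (IG_weight _ _ s); first ring.
    by rewrite -splitr.
  rewrite ler_wpM2r ?IG_weight_ge0// mulNr expRN ler_pdivrMr ?expR_gt0//.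
  have -> : s `^ (- (a' - a)) = s^-1 `^ (a' - a).
    by rewrite -[s^-1]powR_inv1 ?ltW// -powRrM mulN1r.
  by apply: CE; rewrite invr_gt0.
Qed.

(** The recursion Gamma(a + 1) = a Gamma(a). Let A and V be the integrals for shapes a and a + 1.
    Changing the rate from b to x b multiplies A by x^(-a); the same change inserts exp(- (x b - b)
    / s), so Jensen bounds the result below by A exp(- b (x - 1) V / A). Hence a ln x <= (b V / A)
    (x - 1) for all x > 0, and [ln_tangent_slope] gives b V / A = a. *)
Lemma IG_integral_succ a b : 0 < a -> 0 < b -> (IG_integral a b < +oo)%E ->
  IG_integral (a + 1) b = ((a / b)%:E * IG_integral a b)%E.
Proof.
move=> a0 b0 fin.
have fin1 c : 0 < c -> (IG_integral a c < +oo)%E.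
  by move=> c0; exact: IG_integral_fin fin.
have fin2 : (IG_integral (a + 1) b < +oo)%E.
  by apply: IG_integral_fin fin => //; rewrite lerDl.
have iE c d : (IG_integral c d < +oo)%E -> IG_integral c d = (fine (IG_integral c d))%:E.
  by move=> h; rewrite fineK// ge0_fin_numE// IG_integral_ge0.
have pos c d : (IG_integral c d < +oo)%E -> 0 < fine (IG_integral c d).
  by move=> h; rewrite -lte_fin -iE// lt_neqAle eq_sym IG_integral_neq0 IG_integral_ge0.
have int c d : (IG_integral c d < +oo)%E ->
    lebesgue_measure.-integrable `]0%R, +oo[ (EFin \o IG_weight c d).
  move=> h; apply/integrableP; split.
    by apply/measurable_EFinP; apply: measurable_funTS; exact: measurable_IG_weight.
  by under eq_integral do rewrite gee0_abs ?lee_fin ?IG_weight_ge0//.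
set A := fine (IG_integral a b); set V := fine (IG_integral (a + 1) b).
have A0 : 0 < A by exact: pos.
have V0 : 0 < V by exact: pos.
have wV s : 0 < s -> IG_weight a b s * s^-1 = IG_weight (a + 1) b s.
  move=> s0; rewrite -powR_inv1 ?ltW// mulrC.
  have := IG_weightM a b (-1) 0 s0.
  by rewrite oppr0 mul0r expR0 mulr1 addr0 opprK.
suff bV : b * (V / A) = a.
  rewrite iE// (iE a b)// -/A -/V -EFinM; congr EFin.
  by rewrite -bV; field; rewrite !gt_eqF.
apply: ln_tangent_slope => // [|x x0]; first by rewrite mulr_gt0// divr_gt0.
have xb0 : 0 < x * b by rewrite mulr_gt0.
have mD : @measurable _ (measurableTypeR R) `]0%R, +oo[ by exact: measurable_itv.
have := @integral_expRN_ge _ _ _ (@lebesgue_measure R) `]0%R, +oo[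
  (IG_weight a b) (fun s => (x * b - b) * s^-1) A ((x * b - b) * (V / A)).
move=> /(_ (measurable_itv _)).
move=> /(_ (fun s _ => IG_weight_ge0 a b s)).
have wc s : 0 < s -> IG_weight a b s * ((x * b - b) * s^-1) = (x * b - b) * IG_weight (a + 1) b s.
  by move=> s0; rewrite mulrCA wV.
have mc : measurable_fun (`]0%R, +oo[%classic : set R) (fun s : R => (x * b - b) * s^-1).
  by apply: measurable_funTS; apply: measurable_funM => //; exact: measurable_inv.
move=> /(_ mc (int _ _ fin)).
have ic : lebesgue_measure.-integrable `]0%R, +oo[
    (EFin \o (fun s => IG_weight a b s * ((x * b - b) * s^-1))).
  have := integrableZl mD (x * b - b) (int _ _ fin2).
  apply: eq_integrable => // s; rewrite inE/= in_itv/= andbT => s0.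
  by rewrite wc// EFinM.
move=> /(_ ic (iE _ _ fin)).
have VE : (\int[lebesgue_measure]_(s in `]0%R, +oo[) (IG_weight a b s * ((x * b - b) * s^-1))%:E
     = (A * ((x * b - b) * (V / A)))%:E)%E.
  under eq_integral => s.
    rewrite inE/= in_itv/= andbT => s0; rewrite wc// EFinM; over.
  rewrite integralZl//; last exact: int.
  rewrite -/(IG_integral _ _) iE// -EFinM -/V; congr EFin.
  by field; rewrite gt_eqF.
move=> /(_ VE).
have -> : (\int[lebesgue_measure]_(s in `]0%R, +oo[) (IG_weight a b s *
  expR (- ((x * b - b) * s^-1)))%:E
    = IG_integral a (x * b))%E.
  apply: eq_integral => s _; rewrite /IG_weight -mulrA -expRD; congr (_ * expR _)%:E; ring.
rewrite IG_integral_scale// (iE a 1) ?fin1// -EFinM lee_fin.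
have AE : A = b `^ (- a) * fine (IG_integral a 1).
  by rewrite /A IG_integral_scale// (iE a 1) ?fin1.
set t := (x * b - b) * (V / A).
rewrite {1}AE mulrAC ler_pM2r; last exact/pos/fin1.
rewrite (powRM _ (ltW x0) (ltW b0)) (mulrC (x `^ _)) ler_pM2l ?powR_gt0//.
rewrite /powR gt_eqF// ler_expR mulNr lerN2 => /le_trans; apply.
by rewrite le_eqVlt; apply/orP; left; apply/eqP; rewrite /t; ring.
Qed.

End inverse_gamma_integral.

(** * Products of inverse Gamma laws *)

Section independence.
Import HBNNSimple.

(** From indicators to simple functions by linearity, then to [f] by monotone convergence; since [c]
    is finite, multiplication by it commutes with the limit. *)
Lemma ge0_integral_indep d (T : measurableType d) d' (T' : measurableType d')
    (R : realType) (mu : {measure set T -> \bar R}) (X : T -> T') (G : T -> R)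
    (c : \bar R) (f : T' -> R) :
    measurable_fun setT X -> measurable_fun setT G -> (forall t, 0 <= G t) ->
    c \is a fin_num ->
    (forall A, measurable A ->
      \int[mu]_t (\1_A (X t) * G t)%:E = \int[mu]_t (\1_A (X t))%:E * c)%E ->
    measurable_fun setT f -> (forall x, 0 <= f x) ->
  (\int[mu]_t (f (X t) * G t)%:E = \int[mu]_t (f (X t))%:E * c)%E.
Proof.
move=> mX mG G0 cfin H mf f0.
have mf' : measurable_fun setT (EFin \o f) by exact/measurable_EFinP.
pose h := nnsfun_approx measurableT mf'.
have mhX n : measurable_fun setT (fun t => h n (X t)) by exact: measurableT_comp.
have hcvg x : (h n x)%:E @[n --> \oo] --> (f x)%:E.
  by apply: (cvg_nnsfun_approx measurableT mf') => // y _; rewrite lee_fin.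
have hnd x : {homo (fun n => h n x) : m n / (m <= n)%N >-> m <= n}.
  by move=> m n mn; exact/lefP/nd_nnsfun_approx.
have simple n : (\int[mu]_t (h n (X t) * G t)%:E = \int[mu]_t (h n (X t))%:E * c)%E.
  have m1 y : measurable_fun setT (fun t => \1_(h n @^-1` [set y]) (X t) : R).
    by apply: measurableT_comp => //; exact: measurable_indic.
  have y0 y t : 0 <= y * \1_(h n @^-1` [set y]) (X t).
    by rewrite -lee_fin nnfun_muleindic_ge0.
  have -> : (\int[mu]_t (h n (X t))%:E =
      \sum_(y \in range (h n)) \int[mu]_t (y * \1_(h n @^-1` [set y]) (X t))%:E)%E.
    rewrite -ge0_integral_fsum//; last 2 first.
    - by move=> y; apply/measurable_EFinP; exact: measurable_funM.
    - by move=> y t _; rewrite lee_fin.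
    by apply: eq_integral => t _; rewrite fsumEFin// -fimfunE.
  rewrite ge0_mule_fsuml; last first.
    by move=> y; apply: integral_ge0 => t _; rewrite lee_fin.
  have -> : (\int[mu]_t (h n (X t) * G t)%:E =
      \sum_(y \in range (h n)) \int[mu]_t (y * \1_(h n @^-1` [set y]) (X t) * G t)%:E)%E.
    rewrite -ge0_integral_fsum//; last 2 first.
    - by move=> y; apply/measurable_EFinP; apply: measurable_funM => //; exact: measurable_funM.
    - by move=> y t _; rewrite lee_fin mulr_ge0.
    apply: eq_integral => t _; rewrite fimfunE.
    rewrite EFinM -fsumEFin// ge0_mule_fsuml// => y; by rewrite lee_fin.
  apply: eq_fsbigr => y; rewrite inE => -[x _ yE].
  have yge0 : 0 <= y by rewrite -yE.
  under eq_integral do rewrite -mulrA EFinM.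
  under [in RHS]eq_integral do rewrite EFinM.
  rewrite !ge0_integralZl//.
  - by rewrite H ?muleA.
  - by apply/measurable_EFinP; exact: m1.
  - by apply/measurable_EFinP; exact: measurable_funM.
  - by move=> t _; rewrite lee_fin mulr_ge0.
transitivity (limn (fun n => \int[mu]_t (h n (X t) * G t)%:E)%E).
  rewrite -monotone_convergence//.
  - apply: eq_integral => t _; apply/esym/cvg_lim => //.
    under eq_fun do rewrite EFinM; rewrite EFinM.
    by apply: cvgeZr.
  - by move=> n; apply/measurable_EFinP; exact: measurable_funM.
  - by move=> n t _; rewrite lee_fin mulr_ge0.
  - by move=> t _ m n mn; rewrite lee_fin ler_wpM2r// hnd.
under eq_fun do rewrite simple.
have icvg : (\int[mu]_t (h n (X t))%:E @[n --> \oo] --> \int[mu]_t (f (X t))%:E)%E.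
  have -> : (\int[mu]_t (f (X t))%:E = \int[mu]_t (limn (fun n => (h n (X t))%:E)))%E.
    by apply: eq_integral => t _; apply/esym/cvg_lim.
  apply: cvg_monotone_convergence => //.
  - by move=> n; apply/measurable_EFinP; exact: mhX.
  - by move=> n t _; rewrite lee_fin.
  - by move=> t _ m n mn; rewrite lee_fin hnd.
by apply/cvg_lim => //; exact: cvgeZr.
Qed.

End independence.

Section IG_product.
Context {R : realType} {n : nat}.
Variables (al be : 'I_n -> R) (mu : probability (n.-tuple R) R).
Hypothesis muE : is_IG_product al be mu.

Lemma measurable_rectangle (A : 'I_n -> set R) : (forall i, measurable (A i)) ->
  measurable [set s : n.-tuple R | forall i, A i (tnth s i)].
Proof.
move=> mA; rewrite (_ : [set s | _] =
  \bigcap_(i in [set: 'I_n]) ((@tnth _ _ ^~ i) @^-1` (A i))); last first.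
  by apply/seteqP; split=> s /= h i; [move=> _; exact: h|exact: (h i I)].
apply: fin_bigcap_measurable => // i _; rewrite -[X in measurable X]setTI.
exact: measurable_tnth.
Qed.

Lemma measurable_orthant : measurable (orthant n : set (n.-tuple R)).
Proof.
rewrite (_ : orthant n = [set s | forall i, `]0%R, +oo[%classic (tnth s i)]).
  by apply: (@measurable_rectangle (fun=> `]0%R, +oo[%classic)) => i; exact: measurable_itv.
by apply/seteqP; split=> s /= h i; have := h i; rewrite in_itv/= andbT.
Qed.

Let IG_split i A : measurable A ->
  IG (al i) (be i) A = ((IG_mass (al i) (be i))^-1%:E *
    \int[@lebesgue_measure R]_(s in A `&` `]0%R, +oo[) (IG_weight (al i) (be i) s)%:E)%E.
Proof.
move=> mA; rewrite /IG /IG_pdf.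
under eq_integral do rewrite mulrC EFinM.
have mAI : @measurable _ (measurableTypeR R) (A `&` `]0%R, +oo[).
  by apply: measurableI => //; exact: measurable_itv.
rewrite ge0_integralZl//.
- by apply/measurable_EFinP; apply: measurable_funTS; exact: measurable_IG_weight.
- by move=> s _; rewrite lee_fin IG_weight_ge0.
- by rewrite lee_fin invr_ge0 fine_ge0// IG_integral_ge0.
Qed.

Lemma IG_neq0 i : IG (al i) (be i) setT != 0%E.
Proof.
apply/eqP => IG0.
have : mu setT = 0%E.
  rewrite -(_ : [set s : n.-tuple R | forall i, [set: R] (tnth s i)] = setT).
    by rewrite (muE (A := fun=> setT))// (bigD1 i)//= IG0 mul0e.
  by apply/seteqP; split.
by rewrite probability_setT => /eqP; rewrite onee_eq0.
Qed.

(** Read off from the existence of [mu]: an infinite integral would have [IG_mass] equal to 0, whose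
    inverse is 0, and the i-th factor of the total mass of [mu] would vanish. *)
Lemma IG_integral_lty i : (IG_integral (al i) (be i) < +oo)%E.
Proof.
have := IG_neq0 i; rewrite IG_split// setTI.
rewrite /IG_mass -/(IG_integral _ _) ltey; apply: contra_neq => ->.
by rewrite /= invr0 mul0e.
Qed.

Lemma IG_mass_gt0 i : 0 < IG_mass (al i) (be i).
Proof.
rewrite fine_gt0// IG_integral_lty andbT lt_neqAle eq_sym IG_integral_neq0.
exact: IG_integral_ge0.
Qed.

Lemma IG_integralE i : IG_integral (al i) (be i) = (IG_mass (al i) (be i))%:E.
Proof.
by rewrite fineK// ge0_fin_numE ?IG_integral_lty// IG_integral_ge0.
Qed.

Lemma IG_setT i : IG (al i) (be i) setT = 1%E.
Proof.
rewrite IG_split// setTI -/(IG_integral _ _) IG_integralE -EFinM mulVf//.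
by rewrite gt_eqF// IG_mass_gt0.
Qed.

Lemma marginal_IG i A : measurable A ->
  mu ((@tnth _ _ ^~ i) @^-1` A) = IG (al i) (be i) A.
Proof.
move=> mA; pose A' j := if j == i then A else setT.
rewrite (_ : _ @^-1` _ = [set s | forall j, A' j (tnth s j)]).
  rewrite muE; last by move=> j; rewrite /A'; case: ifP.
  rewrite (bigD1 i)//= /A' eqxx big1 ?mule1// => j /negbTE ->.
  exact: IG_setT.
apply/seteqP; split=> s /=; last by move=> /(_ i); rewrite /A' eqxx.
by move=> h j; rewrite /A'; case: eqVneq => [->|].
Qed.

Lemma marginal_orthant : mu (orthant n) = 1%E.
Proof.
rewrite (_ : orthant n = [set s | forall i, `]0%R, +oo[%classic (tnth s i)]).
  rewrite (muE (A := fun=> `]0%R, +oo[%classic)) => [|i]; last exact: measurable_itv.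
  rewrite big1// => i _; rewrite -(IG_setT i) /IG setIid setTI//.
by apply/seteqP; split=> s /= h i; have := h i; rewrite in_itv/= andbT.
Qed.

Lemma ge0_integral_marginal i (g : R -> \bar R) :
    measurable_fun setT g -> (forall x, 0 <= g x)%E ->
  (\int[mu]_s g (tnth s i) =
   \int[@lebesgue_measure R]_(x in `]0%R, +oo[) (g x * (IG_pdf (al i) (be i) x)%:E))%E.
Proof.
move=> mg g0.
pose f : R -> R := (IG_pdf (al i) (be i)) \_ `]0%R, +oo[.
have mpdf : measurable_fun [set: R] (IG_pdf (al i) (be i)).
  by apply: measurable_funM => //; exact: measurable_IG_weight.
have mf : measurable_fun [set: R] f.
  by apply/(measurable_restrictT _ _).1 => //; exact: measurable_funTS.
have f0 x : 0 <= f x.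
  rewrite /f patchE; case: ifP => // _.
  by rewrite mulr_ge0 ?IG_weight_ge0 ?invr_ge0 ?ltW// IG_mass_gt0.
have fE A : (\int[@lebesgue_measure R]_(x in A) (f x)%:E = IG (al i) (be i) A)%E.
  rewrite /IG integral_mkcondr; apply: eq_integral => x _.
  by rewrite /f !patchE; case: ifP.
have f1 : (\int[@lebesgue_measure R]_x (f x)%:E = 1)%E by rewrite fE IG_setT.
have [Q QE] := @density_probability _ (measurableTypeR R) R lebesgue_measure f mf f0 f1.
rewrite (@ge0_integral_law _ _ _ (measurableTypeR R) R mu Q (@tnth _ _ ^~ i) g)//; last 2 first.
- exact: measurable_tnth.
- move=> A mA; transitivity (IG (al i) (be i) A); first exact: marginal_IG.
  by rewrite -fE; exact/esym/QE.
rewrite (@ge0_integral_density _ _ _ Q lebesgue_measure f)//.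
rewrite [RHS]integral_mkcond; apply: eq_integral => x _.
by rewrite /f !patchE; case: ifP => // _; rewrite mule0.
Qed.

Lemma ge0_integral_prod (g : 'I_n -> R -> R) :
    (forall i, measurable_fun setT (g i)) -> (forall i x, 0 <= g i x) ->
    (forall i, \int[mu]_s (g i (tnth s i))%:E < +oo)%E ->
  (\int[mu]_s (\prod_i g i (tnth s i))%:E = \prod_i \int[mu]_s (g i (tnth s i))%:E)%E.
Proof.
move=> mg g0 gfin.
(* Induction on the number [k] of coordinates that may carry an arbitrary factor, the others
   carrying indicators. For k = 0 the claim is the definition of the product law on rectangles. *)
have ind k : forall g : 'I_n -> R -> R,
    (forall i, measurable_fun setT (g i)) -> (forall i x, 0 <= g i x) ->
    (forall i, \int[mu]_s (g i (tnth s i))%:E < +oo)%E ->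
    (forall i : 'I_n, (k <= i)%N -> exists2 A, measurable A & g i = \1_A) ->
  (\int[mu]_s (\prod_i g i (tnth s i))%:E = \prod_i \int[mu]_s (g i (tnth s i))%:E)%E;
  last first.
  by apply: (ind n) => // i; rewrite leqNgt ltn_ord.
elim: k => {mg g0 gfin g} [g mg g0 gfin gi|k IH g mg g0 gfin gi].
  have /choice[A AE] i : exists A, measurable A /\ g i = \1_A.
    by have [//|A mA gA] := gi i; exists A.
  have -> : (\int[mu]_s (\prod_i g i (tnth s i))%:E =
      mu [set s : n.-tuple R | forall i, A i (tnth s i)])%E.
    have mR : measurable [set s : n.-tuple R | forall i, A i (tnth s i)].
      by apply: measurable_rectangle => i; have [] := AE i.
    rewrite -[in RHS](setIT [set s | _]) -integral_indic//.
    apply: eq_integral => s _; congr EFin; rewrite indicE.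
    have [/set_mem As|] := boolP (s \in _).
      rewrite big1// => i _; have [_ ->] := AE i; rewrite indicE mem_set//; exact: As.
    rewrite notin_setE/= => /existsNP[i nA].
    by rewrite (bigD1 i)//= (AE i).2 indicE memNset// mul0r.
  rewrite muE => [|i]; last by have [] := AE i.
  apply: eq_bigr => i _; have [mA ->] := AE i.
  rewrite -marginal_IG//.
  rewrite -[in LHS](setIT (_ @^-1` _)) -integral_indic//.
  by rewrite -[X in measurable X]setTI; exact: measurable_tnth.
have [nk|kn] := leqP n k.
  by apply: IH => // i ki; have := leq_trans nk ki; rewrite leqNgt ltn_ord.
pose i0 := Ordinal kn.
have int0 i : (0 <= \int[mu]_s (g i (tnth s i))%:E)%E.
  by apply: integral_ge0 => s _; rewrite lee_fin.
rewrite [RHS](bigD1 i0)//=; under eq_integral do rewrite (bigD1 i0)//=.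
apply: ge0_integral_indep => //.
- exact: measurable_tnth.
- under eq_fun do rewrite big_mkcond/=.
  apply: measurable_prod => i _; case: (i != i0) => //.
  by apply: measurableT_comp => //; exact: measurable_tnth.
- by move=> s; apply: prodr_ge0.
- by apply: prode_fin_num => i _; rewrite ge0_fin_numE.
(* With an indicator at [i0] only the coordinates below [k] are arbitrary, so the induction
   hypothesis supplies the case of indicators of [ge0_integral_indep]. *)
- move=> A mA; pose g' i : R -> R := if i == i0 then \1_A else g i.
  have g'i i : i != i0 -> g' i = g i by rewrite /g' => /negbTE ->.
  have g'0 : g' i0 = \1_A by rewrite /g' eqxx.
  have IHg : (\int[mu]_s (\prod_i g' i (tnth s i))%:E =
      \prod_i \int[mu]_s (g' i (tnth s i))%:E)%E.
    apply: IH => [i|i x|i|i ki].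
    + by rewrite /g'; case: eqP => // _; exact: measurable_indic.
    + by rewrite /g'; case: eqP => // _; rewrite indicE.
    + have [->|ii0] := eqVneq i i0; last by rewrite g'i.
      rewrite g'0; apply: (@le_lt_trans _ _ (\int[mu]_s (cst 1%E s))%E).
        apply: ge0_le_integral => //.
        * by apply/measurable_EFinP; apply: measurableT_comp;
            [exact: measurable_indic|exact: measurable_tnth].
        * by move=> s _; rewrite lee_fin indicE; case: (_ \in _).
      by rewrite integral_cst//= probability_setT mule1 ltry.
    + have [->|ii0] := eqVneq i i0; first by exists A.
      rewrite g'i//; apply: gi.
      by rewrite ltn_neqAle ki andbT; apply: contra_neq ii0 => ki'; exact/val_inj.
  move: IHg; rewrite [X in _ = X](bigD1 i0)//= g'0.
  under eq_integral do rewrite (bigD1 i0)//= g'0.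
  under [X in (_ * X)%E]eq_bigr => i ii0 do rewrite g'i//.
  move=> <-; apply: eq_integral => s _; congr (_ * _)%:E.
  by apply: eq_bigr => i ii0; rewrite g'i.
Qed.

End IG_product.

(** * The finite-dimensional minimisation *)

Lemma expRN_lipschitz (R : realType) (x y : R) : 0 <= x -> 0 <= y ->
  `|expR (- x) - expR (- y)| <= `|x - y|.
Proof.
wlog xy : x y / x <= y => [h x0 y0|x0 y0].
  have [xy|/ltW yx] := leP x y; first exact: h.
  by rewrite distrC (distrC x) h.
rewrite ger0_norm ?subr_ge0 ?ler_expR ?lerN2// ler0_norm ?subr_le0// opprB.
have -> : expR (- y) = expR (- x) * expR (x - y) by rewrite -expRD; congr expR; ring.
have h1 : expR (- x) <= 1 by rewrite expR_le1 oppr_le0.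
have h2 : 1 - expR (x - y) <= y - x by have := expR_ge1Dx (x - y); lra.
have h3 : 0 <= 1 - expR (x - y) by rewrite subr_ge0 expR_le1 subr_le0.
have := expR_ge0 (- x); nra.
Qed.

Section tilted_minimisation.
Context d (T : measurableType d) (R : realType) (P : probability T R) (n : nat).
Variables (r : 'I_n -> T -> R) (a b : 'I_n -> R).
Hypotheses (mr : forall i, measurable_fun setT (r i))
  (r0 : forall i t, 0 <= r i t)
  (ir : forall i, P.-integrable setT (EFin \o r i))
  (a0 : forall i, 0 < a i) (b0 : forall i, 0 < b i).
Implicit Types p : 'I_n -> R.

Definition tilt_exponent p t := 2^-1 * \sum_i p i * r i t.

Definition tilt_mass p := fine (\int[P]_t (expR (- tilt_exponent p t))%:E)%E.

(** The function G; [a] will be the posterior shapes and [b] the prior rates. *)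
Definition tilt_objective p := - ln (tilt_mass p) + \sum_i (b i * p i - a i * ln (p i)).

Lemma measurable_tilt_exponent p : measurable_fun setT (tilt_exponent p).
Proof.
apply: measurable_funM => //; apply: measurable_sum => i.
exact: measurable_funM.
Qed.

Lemma measurable_expR_tilt p : measurable_fun setT (fun t => expR (- tilt_exponent p t)).
Proof.
apply: measurableT_comp => //; apply: measurableT_comp => //.
exact: measurable_tilt_exponent.
Qed.

Lemma tilt_exponent_ge0 p t : (forall i, 0 <= p i) -> 0 <= tilt_exponent p t.
Proof.
by move=> p0; rewrite mulr_ge0// sumr_ge0// => i _; rewrite mulr_ge0.
Qed.

Lemma integrable_expR_tilt p : (forall i, 0 <= p i) ->
  P.-integrable setT (fun t => (expR (- tilt_exponent p t))%:E).
Proof.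
move=> p0; apply: (@le_integrable _ _ _ P _ measurableT _ (cst 1%E)).
- by apply/measurable_EFinP; exact: measurable_expR_tilt.
- move=> t _ /=; rewrite ger0_norm ?expR_ge0// normr1 lee_fin.
  by rewrite expR_le1 oppr_le0 tilt_exponent_ge0.
- exact: finite_measure_integrable_cst.
Qed.

Lemma tilt_massE p : (forall i, 0 <= p i) ->
  (\int[P]_t (expR (- tilt_exponent p t))%:E = (tilt_mass p)%:E)%E.
Proof. by move=> p0; rewrite fineK// integrable_fin_num// integrable_expR_tilt. Qed.

Lemma tilt_mass_gt0 p : (forall i, 0 <= p i) -> 0 < tilt_mass p.
Proof.
move=> p0; rewrite -lte_fin -tilt_massE// lt_neqAle; apply/andP; split; last first.
  by apply: integral_ge0 => t _; rewrite lee_fin expR_ge0.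
apply/negP => /eqP/esym I0.
have : P setT = 0%E.
  apply: (gt0_integral0_null _ _ _ I0) => //; first exact: measurable_expR_tilt.
  by move=> t _; exact: expR_gt0.
by rewrite probability_setT => /eqP; rewrite onee_eq0.
Qed.

Lemma tilt_mass_le1 p : (forall i, 0 <= p i) -> tilt_mass p <= 1.
Proof.
move=> p0; rewrite -lee_fin -tilt_massE// -(probability_setT P).
rewrite -[leRHS]mul1e -integral_cst//.
apply: ge0_le_integral => //.
- by apply/measurable_EFinP; exact: measurable_expR_tilt.
- by move=> t _; rewrite lee_fin expR_le1 oppr_le0 tilt_exponent_ge0.
Qed.

(** The exponential of a nonpositive argument is 1-Lipschitz, so the first moments of the r_i serve
    as constants; the factor 1/2 of the exponent is given away. *)
Lemma tilt_mass_lipschitz p p' : (forall i, 0 <= p i) -> (forall i, 0 <= p' i) ->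
  `|tilt_mass p - tilt_mass p'| <=
  \sum_i `|p i - p' i| * fine (\int[P]_t (r i t)%:E)%E.
Proof.
move=> p0 p'0.
have rE i : (\int[P]_t (r i t)%:E = (fine (\int[P]_t (r i t)%:E))%:E)%E.
  by rewrite fineK// integrable_fin_num//; exact: ir.
have ie := integrableB measurableT (integrable_expR_tilt p0) (integrable_expR_tilt p'0).
have mB : measurable_fun setT (fun t => expR (- tilt_exponent p t) - expR (- tilt_exponent p' t)).
  by apply: measurable_funB; exact: measurable_expR_tilt.
rewrite -lee_fin.
have -> : (`|tilt_mass p - tilt_mass p'|%:E =
   `|\int[P]_t (expR (- tilt_exponent p t) - expR (- tilt_exponent p' t))%:E|)%E.
  by rewrite integralB_EFin// ?integrable_expR_tilt// !tilt_massE.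
apply: (le_trans (le_abse_integral _ _ _)) => //; first exact/measurable_EFinP.
apply: (@le_trans _ _ (\int[P]_t \sum_i (`|p i - p' i|%:E * (r i t)%:E))%E).
  apply: ge0_le_integral => //.
  - by apply/measurable_EFinP; exact: measurableT_comp.
  - apply: emeasurable_sum => i; apply: emeasurable_funM => //.
    exact/measurable_EFinP.
  - move=> t _; under eq_bigr do rewrite -EFinM; rewrite sumEFin lee_fin.
    apply: (le_trans (expRN_lipschitz _ _)); rewrite ?tilt_exponent_ge0//.
    rewrite -mulrBr -sumrB normrM (@ger0_norm _ 2^-1)//.
    apply: (@le_trans _ _ (1 * `|\sum_i (p i * r i t - p' i * r i t)|)).
      by rewrite ler_wpM2r//; lra.
    rewrite mul1r (le_trans (ler_norm_sum _ _ _))// ler_sum// => i _.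
    by rewrite -mulrBl normrM (ger0_norm (r0 i t)).
rewrite ge0_integral_sum//; last 2 first.
- by move=> i; apply: emeasurable_funM => //; exact/measurable_EFinP.
- by move=> i t _; rewrite mule_ge0// lee_fin.
rewrite -sumEFin lee_sum// => i _.
rewrite ge0_integralZl//; last 2 first.
- exact/measurable_EFinP.
- by move=> t _; rewrite lee_fin.
by rewrite rE EFinM.
Qed.

Lemma integrable_tilt_moment p i : (forall j, 0 <= p j) ->
  P.-integrable setT (fun t => (expR (- tilt_exponent p t) * r i t)%:E).
Proof.
move=> p0; apply: (@le_integrable _ _ _ P _ measurableT _ (EFin \o r i)) => //.
- by apply/measurable_EFinP; apply: measurable_funM => //; exact: measurable_expR_tilt.
- move=> t _ /=; rewrite lee_fin !ger0_norm ?mulr_ge0 ?expR_ge0//.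
  by rewrite ler_piMl// expR_le1 oppr_le0 tilt_exponent_ge0.
Qed.

(** Multiply p_i by x and let q be the mean of r_i under the tilted law. Jensen gives - ln Z(p') <=
    - ln Z(p) + (x - 1) p_i q / 2, so minimality becomes a_i ln x <= p_i (b_i + q / 2) (x - 1), and
    [ln_tangent_slope] yields p_i (b_i + q / 2) = a_i. *)
Lemma tilt_objective_stationary p : (forall i, 0 < p i) ->
    (forall p', (forall i, 0 < p' i) -> tilt_objective p <= tilt_objective p') ->
  forall i, (\int[P]_t (expR (- tilt_exponent p t) * r i t)%:E =
    (tilt_mass p * (2 * (a i / p i - b i)))%:E)%E.
Proof.
move=> p0 pmin i; have p0' j : 0 <= p j by exact/ltW.
have iM := integrable_tilt_moment i p0'.
set M := fine (\int[P]_t (expR (- tilt_exponent p t) * r i t)%:E)%E.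
have ME : (\int[P]_t (expR (- tilt_exponent p t) * r i t)%:E = M%:E)%E.
  by rewrite fineK// integrable_fin_num.
have M0 : 0 <= M.
  by rewrite fine_ge0//; apply: integral_ge0 => t _; rewrite lee_fin mulr_ge0 ?expR_ge0.
have Z0 := tilt_mass_gt0 p0'.
set q := M / tilt_mass p.
have q0 : 0 <= q by rewrite divr_ge0// ltW.
suff qE : p i * (b i + q / 2) = a i.
  rewrite ME; congr EFin; rewrite -qE /q; field.
  by rewrite !gt_eqF.
apply: ln_tangent_slope => // [|x x0].
  by rewrite mulr_gt0// ltr_wpDr// divr_ge0.
pose p' j := if j == i then x * p j else p j.
have p'0 j : 0 < p' j by rewrite /p'; case: ifP => // _; rewrite mulr_gt0.
have p'0' j : 0 <= p' j by exact/ltW.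
have p'i t : tilt_exponent p' t = tilt_exponent p t + 2^-1 * ((x - 1) * p i * r i t).
  rewrite /tilt_exponent (bigD1 i)//= [in RHS](bigD1 i)//= /p' eqxx.
  rewrite (eq_bigr (fun j => p j * r j t)) => [|j /negbTE -> //]; ring.
have := pmin _ p'0; rewrite /tilt_objective.
have p'ii : p' i = x * p i by rewrite /p' eqxx.
rewrite (bigD1 i)//= [X in _ <= _ + X](bigD1 i)//= p'ii.
have -> : \sum_(j < n | j != i) (b j * p' j - a j * ln (p' j)) =
          \sum_(j < n | j != i) (b j * p j - a j * ln (p j)).
  by apply: eq_bigr => j /negbTE ji; rewrite /p' ji.
rewrite lnM ?posrE//.
suff : - ln (tilt_mass p') <= - ln (tilt_mass p) + 2^-1 * ((x - 1) * p i * q).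
  set S := \sum_(_ < n | _) _; lra.
rewrite -lerBlDl opprK addrC lerBlDl -lerBlDr.
have := @integral_expRN_ge _ _ _ P setT (fun t => expR (- tilt_exponent p t))
  (fun t => 2^-1 * ((x - 1) * p i) * r i t) (tilt_mass p) (2^-1 * ((x - 1) * p i) * q)
  measurableT (fun t _ => expR_ge0 _) (measurable_funM (measurable_cst _) (mr i))
  (integrable_expR_tilt p0').
have E t : expR (- tilt_exponent p t) * (2^-1 * ((x - 1) * p i) * r i t) =
   (2^-1 * ((x - 1) * p i)) * (expR (- tilt_exponent p t) * r i t) by ring.
have iM' : P.-integrable setT (EFin \o (fun t => expR (- tilt_exponent p t) *
  (2^-1 * ((x - 1) * p i) * r i t))).
  have := integrableZl measurableT (2^-1 * ((x - 1) * p i)) iM.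
  by apply: eq_integrable => // t _ /=; rewrite E EFinM.
move=> /(_ iM' (tilt_massE p0')).
have EM : (\int[P]_t (expR (- tilt_exponent p t) * (2^-1 * ((x - 1) * p i) * r i t))%:E =
  (tilt_mass p * (2^-1 * ((x - 1) * p i) * q))%:E)%E.
  under eq_integral do rewrite E EFinM.
  rewrite integralZl// ME -EFinM; congr EFin; rewrite /q; field.
  by rewrite gt_eqF.
move=> /(_ EM).
have -> : (\int[P]_t (expR (- tilt_exponent p t) * expR (- (2^-1 * ((x - 1) * p i) * r i t)))%:E =
  (tilt_mass p')%:E)%E.
  rewrite -tilt_massE//; apply: eq_integral => t _; rewrite -expRD p'i.
  by congr (expR _)%:E; ring.
rewrite lee_fin -(@ler_ln _ (_ * _)) ?posrE ?mulr_gt0 ?expR_gt0 ?tilt_mass_gt0//.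
rewrite lnM ?posrE ?expR_gt0// expRK; lra.
Qed.

(** Below [lo] the logarithm alone exceeds |C|. For large x half of the linear term pays for the
    logarithm, by its tangent at 2 a / b, whose intercept is [K]; the other half exceeds |C| + |K|
    beyond [hi]. The bounds around 1 keep the point (1, ..., 1) inside the box. *)
Lemma tilt_objective_coercive i (C : R) : exists lo hi : R,
  [/\ 0 < lo, lo <= 1, 1 <= hi & forall x, 0 < x -> ~~ (lo <= x <= hi) ->
    C <= b i * x - a i * ln x].
Proof.
pose K := a i - a i * ln (2 * a i / b i).
have [ai bi] := (a0 i, b0 i).
exists (expR (- (`|C| / a i))), (1 + 2 / b i * (`|C| + `|K|)); split.
- exact: expR_gt0.
- by rewrite expR_le1 oppr_le0 divr_ge0// ltW.
- by rewrite lerDl mulr_ge0 ?addr_ge0// divr_ge0// ltW.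
move=> x x0; rewrite negb_and -!ltNge => /orP[xlo|xhi].
  have : a i * ln x <= - `|C|.
    rewrite -ler_pdivlMl// mulrC mulNr -(expRK (- _)) ler_ln ?posrE ?expR_gt0//.
    exact: ltW.
  have := ler_norm C; have : 0 <= b i * x by rewrite mulr_ge0// ltW.
  lra.
have h1 : `|C| + `|K| <= b i * x / 2.
  have : 2 / b i * (`|C| + `|K|) <= x by lra.
  rewrite -ler_pdivlMl ?divr_gt0// => /le_trans; apply.
  by rewrite le_eqVlt; apply/orP; left; apply/eqP; field; rewrite gt_eqF.
have h2 : a i * ln x <= b i * x / 2 - K.
  have y0 : 0 < x * b i / (2 * a i) by rewrite divr_gt0 ?mulr_gt0.
  have := expR_ge1Dx (ln (x * b i / (2 * a i))).
  rewrite lnK ?posrE// => h.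
  have E : ln x = ln (x * b i / (2 * a i)) + ln (2 * a i / b i).
    rewrite -lnM ?posrE ?divr_gt0 ?mulr_gt0//; congr ln; field.
    by rewrite !gt_eqF.
  have : a i * (1 + ln (x * b i / (2 * a i))) <= a i * (x * b i / (2 * a i)).
    by rewrite ler_wpM2l// ltW.
  have -> : a i * (x * b i / (2 * a i)) = b i * x / 2 by field; rewrite gt_eqF.
  rewrite /K E; lra.
have := ler_norm C; have := ler_norm (- K); rewrite normrN; lra.
Qed.

(** The bound is the value at the minimiser x = a_i / b_i. *)
Lemma tilt_objective_term_ge i x : 0 < x ->
  a i - a i * ln (a i / b i) <= b i * x - a i * ln x.
Proof.
move=> x0; have [ai bi] := (a0 i, b0 i).
have y0 : 0 < x * b i / a i by rewrite divr_gt0 ?mulr_gt0.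
have := expR_ge1Dx (ln (x * b i / a i)); rewrite lnK ?posrE// => h.
have E : ln x = ln (x * b i / a i) + ln (a i / b i).
  rewrite -lnM ?posrE ?divr_gt0 ?mulr_gt0//; congr ln; field.
  by rewrite !gt_eqF.
have : a i * (1 + ln (x * b i / a i)) <= a i * (x * b i / a i).
  by rewrite ler_wpM2l// ltW.
have -> : a i * (x * b i / a i) = b i * x by field; rewrite gt_eqF.
rewrite E; lra.
Qed.

(** The absolute values extend the mass to all real vectors, so that continuity can be stated on a
    whole space; they disappear on the positive box. *)
Lemma continuous_tilt_mass (W : topologicalType) (x : 'I_n -> W -> R) :
  (forall i, continuous (x i)) -> continuous (fun w => tilt_mass (fun i => `|x i w|)).
Proof.
move=> cx v.
pose B (w : W) := \sum_i `|x i v - x i w| * fine (\int[P]_t (r i t)%:E)%E.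
have cB : B w @[w --> v] --> (0 : R).
  have -> : (0 : R) = B v.
    by rewrite /B big1// => i _; rewrite subrr normr0 mul0r.
  apply: cvg_big => [|i _]; first exact: add_continuous.
  apply: cvgM; last exact: cvg_cst.
  by apply: cvg_norm; apply: cvgB; [exact: cvg_cst|exact: cx].
apply/cvgrPdist_lt => e e0; move/cvgrPdist_lt: cB => /(_ e e0).
apply: filterS => w; rewrite sub0r normrN => /(le_lt_trans (ler_norm _)).
apply: le_lt_trans; apply: (le_trans (tilt_mass_lipschitz _ _)) => //.
apply: ler_sum => i _; rewrite ler_wpM2r//.
  by rewrite fine_ge0//; apply: integral_ge0 => t _; rewrite lee_fin.
exact: ler_dist_dist.
Qed.

Lemma continuous_tilt_objective (W : topologicalType) (x : 'I_n -> W -> R) v :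
    (forall i, continuous (x i)) -> (forall i, 0 < x i v) ->
  {for v, continuous (fun w => tilt_objective (fun i => `|x i w|))}.
Proof.
move=> cx x0.
have cn i : `|x i w| @[w --> v] --> `|x i v| by apply: cvg_norm; exact: cx.
apply: cvgD.
  apply: cvgN; apply: continuous_cvg; last exact: continuous_tilt_mass.
  by apply: continuous_ln; apply: tilt_mass_gt0 => i; exact: normr_ge0.
apply: cvg_big => [|i _]; first exact: add_continuous.
apply: cvgB; apply: cvgM; [exact: cvg_cst|exact: cn|exact: cvg_cst|].
apply: continuous_cvg; last exact: cn.
by apply: continuous_ln; rewrite normr_gt0 gt_eqF.
Qed.

Lemma tilt_objective_min : exists2 p, (forall i, 0 < p i) &
  forall p', (forall i, 0 < p' i) -> tilt_objective p <= tilt_objective p'.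
Proof.
pose one : 'I_n -> R := fun=> 1.
pose c i := a i - a i * ln (a i / b i).
(* The other terms are at least [c k] and [- ln (tilt_mass p')] is nonnegative, so a p' whose i-th
   term reaches [C i] does no better than [one]. *)
pose C i := tilt_objective one - \sum_(k < n | k != i) c k.
have /choice[lo hlo] i : exists lo, exists hi : R, [/\ 0 < lo, lo <= 1, 1 <= hi &
    forall x, 0 < x -> ~~ (lo <= x <= hi) -> C i <= b i * x - a i * ln x].
  exact: tilt_objective_coercive.
have /choice[hi hhi] i : exists hi : R, [/\ 0 < lo i, lo i <= 1, 1 <= hi &
    forall x, 0 < x -> ~~ (lo i <= x <= hi) -> C i <= b i * x - a i * ln x].
  exact: hlo.
pose A := [set v : 'rV[R]_n | forall i, v ord0 i \in `[lo i, hi i]].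
have cA : compact A.
  by apply: (rV_compact (A := fun i => `[lo i, hi i]%classic)) => i; exact: segment_compact.
pose row p : 'rV[R]_n := \row_i p i.
have A1 : A (row one).
  by move=> i; rewrite mxE in_itv/=; have [_ -> -> _] := hhi i.
have A0 v : A v -> forall i, 0 < v ord0 i.
  move=> Av i; have := Av i; rewrite in_itv/= => /andP[+ _].
  by have [lo0 _ _ _] := hhi i; exact: lt_le_trans.
pose F (v : 'rV[R]_n) := tilt_objective (fun i => `|v ord0 i|).
have FE v : A v -> F v = tilt_objective (v ord0).
  move=> Av; rewrite /F; congr tilt_objective; apply/funext => i.
  by rewrite gtr0_norm ?A0.
have cF : {within A, continuous F}.
  apply: continuous_in_subspaceT => v /set_mem Av.
  apply: (@continuous_tilt_objective _ (fun i (w : 'rV[R]_n) => w ord0 i)).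
    by move=> i; exact: coord_continuous.
  exact: A0.
have [v /set_mem Av vmin] := EVT_min_rV (ex_intro _ _ A1) cA cF.
exists (v ord0) => [|p' p'0]; first exact: A0.
have rowE p : (row p) ord0 = p by apply/funext => i; rewrite mxE.
have [Ap'|] := pselect (A (row p')).
  by rewrite -FE// (le_trans (vmin _ (mem_set Ap')))// FE// rowE.
move=> /existsNP[i /negP]; rewrite mxE in_itv/= => out.
have [_ _ _ /(_ _ (p'0 i) out) Ci] := hhi i.
have : tilt_objective (v ord0) <= tilt_objective one.
  by rewrite -FE// (le_trans (vmin _ (mem_set A1)))// FE// rowE.
move/le_trans; apply.
rewrite [leRHS]/tilt_objective (bigD1 i)//=.
have Z1 : 0 <= - ln (tilt_mass p').
  by rewrite oppr_ge0 ln_le0// tilt_mass_le1// => j; exact: ltW.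
have S1 : \sum_(k < n | k != i) c k <=
    \sum_(k < n | k != i) (b k * p' k - a k * ln (p' k)).
  by apply: ler_sum => k _; exact: tilt_objective_term_ge.
move: Ci; rewrite /C; lra.
Qed.

End tilted_minimisation.

(** * Integrals against product measures *)

Section has_integral.
Context d (T : measurableType d) (R : realType).

Definition has_integral (mu : {measure set T -> \bar R}) (f : T -> R) (v : R) :=
  mu.-integrable setT (EFin \o f) /\ (\int[mu]_x (f x)%:E = v%:E)%E.

Variable mu : {measure set T -> \bar R}.
Implicit Types f g : T -> R.

Lemma integrable_has_integral f : mu.-integrable setT (EFin \o f) ->
  has_integral mu f (fine (\int[mu]_x (f x)%:E)).
Proof. by move=> h; split=> //; rewrite fineK// integrable_fin_num. Qed.

Lemma ge0_has_integral (f : T -> R) v : measurable_fun setT f -> (forall x, 0 <= f x) ->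
  (\int[mu]_x (f x)%:E = v%:E)%E -> has_integral mu f v.
Proof.
move=> mf f0 fv; split=> //; apply/integrableP; split; first exact/measurable_EFinP.
rewrite (eq_integral (fun x => (f x)%:E)) ?fv ?ltry// => x _ /=.
by rewrite ger0_norm.
Qed.

Lemma has_integralD f g v w : has_integral mu f v -> has_integral mu g w ->
  has_integral mu (fun x => f x + g x) (v + w).
Proof.
move=> [fi fv] [gi gw]; split.
  by have := integrableD measurableT fi gi; apply: eq_integrable.
by rewrite EFinD -fv -gw -integralD_EFin.
Qed.

Lemma has_integralZ c f v : has_integral mu f v ->
  has_integral mu (fun x => c * f x) (c * v).
Proof.
move=> [fi fv]; split.
  by have := integrableZl measurableT c fi; apply: eq_integrable.
by rewrite EFinM -fv -integralZl.
Qed.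

Lemma eq_has_integral g f v : f =1 g -> has_integral mu f v -> has_integral mu g v.
Proof. by move=> /funext ->. Qed.

Lemma has_integral_sum n (f : 'I_n -> T -> R) v :
  (forall i, has_integral mu (f i) (v i)) ->
  has_integral mu (fun x => \sum_i f i x) (\sum_i v i).
Proof.
move=> fv; split.
  have := @integrable_sum _ _ _ mu setT measurableT _ (index_enum _) xpredT
    (fun i => EFin \o f i) (fun i _ => (fv i).1).
  by apply: eq_integrable => // x _ /=; rewrite sumEFin.
under eq_integral do rewrite -sumEFin.
rewrite integral_sum//; last by move=> i; exact: (fv i).1.
by rewrite -sumEFin; apply: eq_bigr => i _; exact: (fv i).2.
Qed.

Lemma ge0_integral_conull (D A : set T) (f : T -> R) :
    measurable A -> measurable D -> mu (~` D) = 0%E ->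
    measurable_fun setT f -> (forall x, 0 <= f x) ->
  (\int[mu]_(x in A `&` D) (f x)%:E = \int[mu]_(x in A) (f x)%:E)%E.
Proof.
move=> mA mD D0 mf f0.
rewrite [RHS](@ge0_negligible_integral _ _ _ _ A (~` D))//.
- by rewrite setDE setCK.
- exact: measurableC.
- by apply/measurable_EFinP; exact: measurable_funTS.
- by move=> x _; rewrite lee_fin.
Qed.

End has_integral.

Lemma has_integral_cst d (T : measurableType d) (R : realType)
  (P : probability T R) (c : R) : has_integral P (cst c) c.
Proof.
split; first exact: finite_measure_integrable_cst.
by rewrite -[LHS]/(\int[P]_x (cst c%:E x))%E integral_cst//= (probability_setT P) mule1.
Qed.

Lemma has_integral_density d (T : measurableType d) (R : realType)
    (nu : {finite_measure set T -> \bar R}) (mu : {sigma_finite_measure set T -> \bar R})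
    (f g : T -> R) (v : R) :
    measurable_fun setT f -> (forall x, 0 <= f x) ->
    (forall A, measurable A -> nu A = \int[mu]_(x in A) (f x)%:E)%E ->
    measurable_fun setT g ->
  has_integral mu (fun x => g x * f x) v -> has_integral nu g v.
Proof.
move=> mf f0 nuE mg [gfi gfv].
have gi : nu.-integrable setT (EFin \o g) by apply/(integrable_density mf f0 nuE).
by split=> //; rewrite (integral_density mf nuE gi).
Qed.

Section product.
Context d1 d2 (T1 : measurableType d1) (T2 : measurableType d2) (R : realType).
Variables (m1 : probability T1 R) (m2 : probability T2 R).

Lemma has_integral_prod (f : T1 -> R) (g : T2 -> R) v w :
    (forall x, 0 <= f x) -> (forall y, 0 <= g y) ->
    has_integral m1 f v -> has_integral m2 g w ->
  has_integral (m1 \x m2)%E (fun z => f z.1 * g z.2) (v * w).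
Proof.
move=> f0 g0 [fi fv] [gi gw].
have mf : measurable_fun setT f by apply/measurable_EFinP; exact: measurable_int fi.
have mg : measurable_fun setT g by apply/measurable_EFinP; exact: measurable_int gi.
have mfg : measurable_fun [set: T1 * T2] (fun z => f z.1 * g z.2).
  by apply: measurable_funM; exact: measurableT_comp.
apply: ge0_has_integral => // [z|]; first by rewrite mulr_ge0.
rewrite fubini_tonelli1//=; last 2 first.
- exact/measurable_EFinP.
- by move=> z; rewrite lee_fin mulr_ge0.
rewrite /fubini_F/= EFinM -fv -ge0_integralZr//; last 3 first.
- exact/measurable_EFinP.
- by move=> x _; rewrite lee_fin.
- by rewrite -gw; apply: integral_ge0 => y _; rewrite lee_fin.
apply: eq_integral => x _; under eq_integral do rewrite EFinM.
rewrite ge0_integralZl//.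
- by rewrite gw.
- exact/measurable_EFinP.
- by move=> y _; rewrite lee_fin.
- by rewrite lee_fin.
Qed.

Variables (mu1 : probability T1 R) (mu2 : probability T2 R).
Variables (f : T1 -> R) (g : T2 -> R).
Hypotheses (mf : measurable_fun setT f) (mg : measurable_fun setT g)
  (f0 : forall x, 0 <= f x) (g0 : forall y, 0 <= g y)
  (m1E : forall A, measurable A -> m1 A = (\int[mu1]_(x in A) (f x)%:E)%E)
  (m2E : forall A, measurable A -> m2 A = (\int[mu2]_(x in A) (g x)%:E)%E).

Lemma product_density A : measurable A ->
  (m1 \x m2)%E A = (\int[mu1 \x mu2]_(z in A) (f z.1 * g z.2)%:E)%E.
Proof.
move=> mA; rewrite integral_mkcond.
have mfg : measurable_fun [set: T1 * T2] (fun z => (f z.1 * g z.2)%:E).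
  by apply/measurable_EFinP; apply: measurable_funM; exact: measurableT_comp.
rewrite fubini_tonelli1//=; last 2 first.
- by apply/(measurable_restrictT _ _).1 => //; exact: measurable_funTS.
- by move=> z; rewrite patchE; case: ifP => // _; rewrite lee_fin mulr_ge0.
rewrite /product_measure1 (ge0_integral_density mf m1E)//; last first.
  exact: measurable_fun_xsection.
apply: eq_integral => x _; rewrite /fubini_F /= m2E; last exact: measurable_xsection.
rewrite muleC -ge0_integralZl//; last 4 first.
- exact: measurable_xsection.
- by apply/measurable_EFinP; exact: measurable_funTS.
- by move=> y _; rewrite lee_fin.
- by rewrite lee_fin.
rewrite integral_mkcond; apply: eq_integral => y _.
by rewrite !patchE mem_xsection; case: ifP => // _; rewrite EFinM.
Qed.

End product.

(** The chain rule for densities; writing the quotient as an exponential avoids a division by [f].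
    It will pass from the prior to the posterior as reference measure. *)
Lemma relative_density d (T : measurableType d) (R : realType)
    (nu mu : probability T R) (lam : {sigma_finite_measure set T -> \bar R})
    (f psi : T -> R) :
    measurable_fun setT f -> measurable_fun setT psi ->
    (forall A, measurable A -> mu A = \int[lam]_(x in A) (f x)%:E)%E ->
    (forall A, measurable A -> nu A = \int[lam]_(x in A) (expR (psi x) * f x)%:E)%E ->
  forall A, measurable A -> nu A = (\int[mu]_(x in A) (expR (psi x))%:E)%E.
Proof.
move=> mf mpsi muE nuE A mA; rewrite nuE// [RHS]integral_mkcond.
rewrite (ge0_integral_density mf muE).
- rewrite [LHS]integral_mkcond; apply: eq_integral => x _.
  by rewrite !patchE; case: ifP => // _; rewrite mul0e.
- apply/(measurable_restrictT _ _).1 => //; apply: measurable_funTS.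
  by apply/measurable_EFinP; exact: measurableT_comp.
- by move=> x; rewrite patchE; case: ifP => // _; rewrite lee_fin expR_ge0.
Qed.

(** * The posterior of the noise variances *)

Lemma measurable_inv_norm (R : realType) : measurable_fun [set: R] (fun x : R => `|x|^-1).
Proof. by apply: (measurableT_comp (@measurable_inv R)); exact: normr_measurable. Qed.

(** The half comes from the normal likelihood, whose determinant contributes sigma_i^(-1/2). *)
Definition posterior_shape (R : realType) (I : Type) (al : I -> R) i := al i + 2^-1.

Section sigma_tilt.
Context {R : realType} {n : nat}.
Implicit Types (s : n.-tuple R) (c : 'I_n -> R).

(* The absolute value makes it nonnegative off the orthant as well. *)
Definition precision (i : 'I_n) s : R := `|tnth s i|^-1.

(** On the orthant, with c_i = E[r_i] / 2, this is the joint potential averaged over u. *)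
Definition sigma_potential c s : R :=
  \sum_i (2^-1 * ln (tnth s i) + c i * precision i s).

Lemma measurable_precision i : measurable_fun setT (precision i).
Proof.
apply: measurableT_comp; first exact: measurable_inv.
by apply: measurableT_comp => //; exact: measurable_tnth.
Qed.

Lemma measurable_ln_tnth i : measurable_fun setT (fun s => ln (tnth s i) : R).
Proof. by apply: measurableT_comp; [exact: measurable_ln|exact: measurable_tnth]. Qed.

Lemma measurable_sigma_potential c : measurable_fun setT (sigma_potential c).
Proof.
apply: measurable_sum => i; apply: measurable_funD; apply: measurable_funM => //.
  exact: measurable_ln_tnth.
exact: measurable_precision.
Qed.

Definition sigma_factor (y x : R) := expR (- (2^-1 * ln x + y * `|x|^-1)).

Lemma measurable_sigma_factor y : measurable_fun setT (sigma_factor y).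
Proof.
apply: measurableT_comp => //; apply: measurableT_comp => //.
apply: measurable_funD; apply: measurable_funM => //.
exact: measurable_inv_norm.
Qed.

#[local] Hint Extern 0 (measurable_fun _ (sigma_factor _)) =>
  solve [exact: measurable_sigma_factor] : core.

Lemma sigma_factorE (x y : R) : 0 < x ->
  sigma_factor y x = x `^ (- 2^-1) * expR (- y / x).
Proof.
by move=> x0; rewrite /sigma_factor opprD expRD /powR gt_eqF// gtr0_norm// !mulNr.
Qed.

Lemma expRN_sigma_potential c s :
  expR (- sigma_potential c s) = \prod_i sigma_factor (c i) (tnth s i).
Proof. by rewrite /sigma_potential -sumrN expR_sum. Qed.

Variables (al be : 'I_n -> R) (mu : probability (n.-tuple R) R).
Hypotheses (muE : is_IG_product al be mu) (al0 : forall i, 0 < al i)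
  (be0 : forall i, 0 < be i).

Local Notation a := (posterior_shape al).

Definition IG_const (x y : R) := fine (IG_integral x y).

Let a0 i : 0 < a i.
Proof. by rewrite /posterior_shape addr_gt0. Qed.

Lemma IG_integral_half_lty i y : 0 < y -> (IG_integral (a i) y < +oo)%E.
Proof.
move=> y0; apply: (IG_integral_fin (be0 i) y0 _ (IG_integral_lty muE i)).
by rewrite /posterior_shape lerDl.
Qed.

Lemma IG_const_gt0 i y : 0 < y -> 0 < IG_const (a i) y.
Proof.
move=> y0; rewrite fine_gt0// IG_integral_half_lty// andbT.
by rewrite lt_neqAle eq_sym IG_integral_neq0 IG_integral_ge0.
Qed.

Lemma IG_constE i y : 0 < y -> IG_integral (a i) y = (IG_const (a i) y)%:E.
Proof.
by move=> y0; rewrite fineK// ge0_fin_numE ?IG_integral_half_lty// IG_integral_ge0.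
Qed.

Lemma ge0_integral_IG_weight i (g : R -> R) (k y : R) :
    measurable_fun setT g -> (forall x, 0 <= g x) ->
    (forall x, 0 < x -> g x = x `^ k * expR (- y / x)) ->
  (\int[mu]_s (g (tnth s i))%:E =
    (IG_mass (al i) (be i))^-1%:E * IG_integral (al i - k) (be i + y))%E.
Proof.
move=> mg g0 gE.
rewrite (ge0_integral_marginal muE i (g := EFin \o g))//; last first.
  exact/measurable_EFinP.
rewrite -ge0_integralZl//; last 3 first.
- by apply/measurable_EFinP; apply: measurable_funTS; exact: measurable_IG_weight.
- by move=> s _; rewrite lee_fin IG_weight_ge0.
- by rewrite lee_fin invr_ge0 ltW// (IG_mass_gt0 muE).
apply: eq_integral => x; rewrite inE/= in_itv/= andbT => x0.
by rewrite -!EFinM; congr EFin; rewrite /IG_pdf -IG_weightM// gE//; ring.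
Qed.

Lemma integral_sigma_factor c i : 0 < be i + c i ->
  (\int[mu]_s (sigma_factor (c i) (tnth s i))%:E =
   ((IG_mass (al i) (be i))^-1 * IG_const (a i) (be i + c i))%:E)%E.
Proof.
move=> bc; rewrite (@ge0_integral_IG_weight i (sigma_factor (c i)) (- 2^-1) (c i))//.
- by rewrite opprK IG_constE.
- by move=> x; exact: expR_ge0.
- by move=> x x0; exact: sigma_factorE.
Qed.

(** The extra 1 / sigma_i raises the shape by one, so the recursion contributes the mean shape /
    rate. *)
Let integral_inv_sigma_factor c i : 0 < be i + c i ->
  (\int[mu]_s (`|tnth s i|^-1 * sigma_factor (c i) (tnth s i))%:E =
   ((IG_mass (al i) (be i))^-1 * IG_const (a i) (be i + c i) * (a i / (be i + c i)))%:E)%E.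
Proof.
move=> bc; rewrite (@ge0_integral_IG_weight i (fun x => `|x|^-1 * sigma_factor (c i) x)
  (- 2^-1 - 1) (c i)).
- rewrite [al i - _](_ : _ = a i + 1); last by rewrite /posterior_shape; ring.
  rewrite IG_integral_succ ?IG_integral_half_lty//.
  by rewrite IG_constE// -!EFinM; congr EFin; ring.
- apply: measurable_funM => //.
  exact: measurable_inv_norm.
- by move=> x; rewrite mulr_ge0 ?expR_ge0// invr_ge0.
- move=> x x0; rewrite sigma_factorE// gtr0_norm// mulrA; congr (_ * _).
  by rewrite -(powR_inv1 (ltW x0)) -powRD ?(gt_eqF x0) ?implybT//; congr (_ `^ _); ring.
Qed.

Definition sigma_mass c :=
  \prod_i ((IG_mass (al i) (be i))^-1 * IG_const (a i) (be i + c i)).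

Lemma has_integral_sigma_mass c : (forall i, 0 < be i + c i) ->
  has_integral mu (fun s => expR (- sigma_potential c s)) (sigma_mass c).
Proof.
move=> bc; apply: ge0_has_integral.
- apply: measurableT_comp => //; apply: measurableT_comp => //.
  exact: measurable_sigma_potential.
- by move=> s; exact: expR_ge0.
under eq_integral do rewrite expRN_sigma_potential.
rewrite (ge0_integral_prod muE (g := fun i => sigma_factor (c i)))//.
- rewrite (eq_bigr _ (fun i _ => integral_sigma_factor (bc i))).
  by rewrite /sigma_mass; elim/big_ind2 : _ => // x1 x2 y1 y2 -> ->.
- by move=> i x; exact: expR_ge0.
- by move=> i; rewrite integral_sigma_factor// ltry.
Qed.

Lemma has_integral_precision c k : (forall i, 0 < be i + c i) ->
  has_integral mu (fun s => precision k s * expR (- sigma_potential c s))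
    (sigma_mass c * (a k / (be k + c k))).
Proof.
move=> bc; apply: ge0_has_integral.
- apply: measurable_funM; first exact: measurable_precision.
  apply: measurableT_comp => //; apply: measurableT_comp => //.
  exact: measurable_sigma_potential.
- by move=> s; rewrite mulr_ge0 ?expR_ge0// invr_ge0.
pose h i (x : R) := (if i == k then `|x|^-1 else 1) * sigma_factor (c i) x.
have hint i : (\int[mu]_s (h i (tnth s i))%:E =
   ((IG_mass (al i) (be i))^-1 * IG_const (a i) (be i + c i) *
   (if i == k then a i / (be i + c i) else 1))%:E)%E.
  rewrite /h; case: eqP => _; first exact: integral_inv_sigma_factor.
  by under eq_integral do rewrite mul1r; rewrite mulr1 integral_sigma_factor.
have E s : precision k s * expR (- sigma_potential c s) = \prod_i h i (tnth s i).
  rewrite expRN_sigma_potential (bigD1 k)//= [RHS](bigD1 k)//= mulrA /h eqxx; congr (_ * _).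
  by apply: eq_bigr => i /negbTE ->; rewrite mul1r.
under eq_integral do rewrite E.
rewrite (ge0_integral_prod muE).
- rewrite (eq_bigr _ (fun i _ => hint i)).
  transitivity (\prod_i ((IG_mass (al i) (be i))^-1 * IG_const (a i) (be i + c i) *
      (if i == k then a i / (be i + c i) else 1)))%:E.
    by elim/big_ind2 : _ => // x1 x2 y1 y2 -> ->.
  by rewrite big_split/= -/(sigma_mass c) -big_mkcond big_pred1_eq.
- move=> i; apply: measurable_funM => //; case: eqP => // _.
  exact: measurable_inv_norm.
- by move=> i x; rewrite mulr_ge0 ?expR_ge0//; case: eqP => // _; rewrite invr_ge0.
- by move=> i; rewrite hint ltry.
Qed.

Lemma sigma_mass_gt0 c : (forall i, 0 < be i + c i) -> 0 < sigma_mass c.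
Proof.
move=> bc; apply: prodr_gt0 => i _.
by rewrite mulr_gt0 ?IG_const_gt0// invr_gt0 (IG_mass_gt0 muE).
Qed.

(** Scaling every rate to 1 isolates the dependence on [c] in one logarithm per coordinate; the rest
    will go into [KL_offset]. *)
Lemma ln_sigma_mass c : (forall i, 0 < be i + c i) ->
  ln (sigma_mass c) = \sum_i (ln (IG_const (a i) 1) - ln (IG_mass (al i) (be i))
    - a i * ln (be i + c i)).
Proof.
move=> bc; have m0 i := IG_mass_gt0 muE i.
apply: expR_inj; rewrite lnK ?posrE ?sigma_mass_gt0// expR_sum.
apply: eq_bigr => i _.
have E : IG_const (a i) (be i + c i) = (be i + c i) `^ (- a i) * IG_const (a i) 1.
  by rewrite {1}/IG_const IG_integral_scale// (IG_constE i ltr01) -EFinM.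
have c1 : IG_const (a i) 1 \is Num.pos by rewrite posrE IG_const_gt0.
have c2 : IG_mass (al i) (be i) \is Num.pos by rewrite posrE.
rewrite E /powR (gt_eqF (bc i)) 2!expRD !expRN (lnK c1) (lnK c2) mulNr expRN.
ring.
Qed.

End sigma_tilt.

(** * The mean-field divergence *)

Section mean_field.
Context d (T : measurableType d) (R : realType) (mu0u : probability T R) (n : nat).
Variables (r : 'I_n -> T -> R) (al be : 'I_n -> R)
  (mu0s : probability (n.-tuple R) R) (Zd : R)
  (mud : probability (T * n.-tuple R)%type R).
Hypotheses (mr : forall i, measurable_fun setT (r i))
  (r0 : forall i t, 0 <= r i t)
  (ir : forall i, mu0u.-integrable setT (EFin \o r i))
  (muE : is_IG_product al be mu0s)
  (al0 : forall i, 0 < al i) (be0 : forall i, 0 < be i) (Zd0 : 0 < Zd).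

Definition joint_potential (z : T * n.-tuple R) : R :=
  \sum_i (2^-1 * (r i z.1 * precision i z.2) + 2^-1 * ln (tnth z.2 i)).

Hypothesis mudE : forall A, measurable A ->
  mud A = (\int[mu0u \x mu0s]_(z in A) (Zd^-1 * expR (- joint_potential z))%:E)%E.

Local Notation a := (posterior_shape al).

Let a0 i : 0 < a i.
Proof. by rewrite /posterior_shape addr_gt0. Qed.

(** Chosen so that the posterior rate is a_i / p_i and the mean of 1 / sigma_i is p_i. For a general
    p it may be negative; only its sum with [be i] is positive. *)
Definition sigma_rate (p : 'I_n -> R) i := a i / p i - be i.

Let rateK p i : be i + sigma_rate p i = a i / p i.
Proof. by rewrite /sigma_rate addrC subrK. Qed.

Let rate_gt0 p (p0 : forall i, 0 < p i) i : 0 < be i + sigma_rate p i.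
Proof. by rewrite rateK divr_gt0. Qed.

Let density_u p t := (tilt_mass mu0u r p)^-1 * expR (- tilt_exponent r p t).
Let density_s p s :=
  (sigma_mass al be (sigma_rate p))^-1 * expR (- sigma_potential (sigma_rate p) s).

(** Logarithm of the density, relative to the posterior, of the product measure attached to [p]. The
    terms in ln sigma_i have cancelled, and the factors 1 give each summand the product form of
    [has_integral_prod]. *)
Let log_density p (z : T * n.-tuple R) : R :=
  - ln (tilt_mass mu0u r p) - ln (sigma_mass al be (sigma_rate p)) + ln Zd +
  \sum_i (- (2^-1 * p i) * (r i z.1 * 1) + (- sigma_rate p i) * (1 * precision i z.2)
    + 2^-1 * (r i z.1 * precision i z.2)).

Lemma measurable_joint_potential : measurable_fun setT joint_potential.
Proof.
apply: measurable_sum => i; apply: measurable_funD; apply: measurable_funM => //.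
  apply: measurable_funM; first exact: measurableT_comp.
  exact: (measurableT_comp (measurable_precision i)).
exact: (measurableT_comp (measurable_ln_tnth i)).
Qed.

Let measurable_log_density p : measurable_fun setT (log_density p).
Proof.
have mp i : measurable_fun [set: T * n.-tuple R] (fun z => precision i z.2 : R).
  exact: (measurableT_comp (measurable_precision i)).
have mri i : measurable_fun [set: T * n.-tuple R] (fun z => r i z.1 : R).
  exact: measurableT_comp.
apply: measurable_funD => //; apply: measurable_sum => i.
by apply: measurable_funD; [apply: measurable_funD|]; apply: measurable_funM => //;
  apply: measurable_funM => //; (exact: mri || exact: mp).
Qed.

Let expR_log_density p z : (forall i, 0 < p i) ->
  expR (log_density p z) * (Zd^-1 * expR (- joint_potential z)) =
  density_u p z.1 * density_s p z.2.
Proof.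
move=> p0; have p0' i : 0 <= p i by exact/ltW.
have Zu0 := tilt_mass_gt0 mu0u mr r0 p0'.
have Zs0 := sigma_mass_gt0 muE be0 (rate_gt0 p0).
have -> : expR (log_density p z) = (tilt_mass mu0u r p)^-1 *
    (sigma_mass al be (sigma_rate p))^-1 * Zd * expR (\sum_i
    (- (2^-1 * p i) * (r i z.1 * 1) + (- sigma_rate p i) * (1 * precision i z.2)
      + 2^-1 * (r i z.1 * precision i z.2))).
  by rewrite /log_density 3!expRD 2!expRN !lnK ?posrE.
rewrite /density_u /density_s [RHS]mulrACA -!mulrA; congr (_ * (_ * _)).
rewrite mulrCA mulVKf ?gt_eqF// -!expRD; congr expR.
rewrite /joint_potential /tilt_exponent /sigma_potential mulr_sumr -!sumrN -!big_split/=.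
by apply: eq_bigr => i _; ring.
Qed.

Definition KL_offset : R := ln Zd + \sum_i (a i * ln (a i) - a i -
  (ln (IG_const (a i) 1) - ln (IG_mass (al i) (be i)))).

Let has_integral_log_density p (nuu : probability T R) (nus : probability (n.-tuple R) R) :
    (forall i, 0 < p i) -> (forall i, nuu.-integrable setT (EFin \o r i)) ->
    (forall i, has_integral nus (precision i) (p i)) ->
  has_integral (nuu \x nus)%E (log_density p) (tilt_objective mu0u r a be p + KL_offset).
Proof.
move=> p0 iru hs; have hr i := integrable_has_integral (iru i).
pose q i := fine (\int[nuu]_t (r i t)%:E)%E.
have pr0 (i : 'I_n) s : 0 <= precision i s :> R by rewrite invr_ge0.
have -> : tilt_objective mu0u r a be p + KL_offset =
  - ln (tilt_mass mu0u r p) - ln (sigma_mass al be (sigma_rate p)) + ln Zd +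
  \sum_i (- (2^-1 * p i) * (q i * 1) + (- sigma_rate p i) * (1 * p i) + 2^-1 * (q i * p i)).
  rewrite (ln_sigma_mass muE be0 (rate_gt0 p0)) /tilt_objective /KL_offset.
  rewrite -[X in _ = - _ - X + _ + _]opprK -sumrN opprK.
  (* [q i] drops out because the mean precision of [nus] is exactly the parameter [p i] of the test
     function. *)
  have E1 : \sum_i (- (2^-1 * p i) * (q i * 1) + (- sigma_rate p i) * (1 * p i)
      + 2^-1 * (q i * p i)) = \sum_i (be i * p i - a i).
    by apply: eq_bigr => i _; rewrite /sigma_rate; field; rewrite gt_eqF.
  rewrite E1 -!addrA; congr (_ + _).
  rewrite [RHS]addrCA [LHS]addrCA; congr (_ + _).
  rewrite -!big_split/=; apply: eq_bigr => i _.
  rewrite rateK ln_div ?posrE//; ring.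
apply: has_integralD.
  exact: (has_integral_cst (nuu \x nus)%E).
have h1u := has_integral_cst nuu 1; have h1s := has_integral_cst nus 1.
have c10 (X : Type) (x : X) : (0 : R) <= cst 1 x by [].
apply: has_integral_sum => i.
apply: has_integralD; first apply: has_integralD.
- exact: has_integralZ _ (has_integral_prod (r0 i) (c10 _) (hr i) h1s).
- exact: has_integralZ _ (has_integral_prod (c10 _) (pr0 i) h1u (hs i)).
- exact: has_integralZ _ (has_integral_prod (r0 i) (pr0 i) (hr i) (hs i)).
Qed.

Let measurable_density : measurable_fun setT (fun z => Zd^-1 * expR (- joint_potential z)).
Proof.
apply: measurable_funM => //; apply: measurableT_comp => //.
by apply: measurableT_comp => //; exact: measurable_joint_potential.
Qed.


Lemma has_integral_density_u p : (forall i, 0 < p i) -> has_integral mu0u (density_u p) 1.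
Proof.
move=> p0; have p0' i : 0 <= p i by exact/ltW.
have Zu0 := tilt_mass_gt0 mu0u mr r0 p0'.
rewrite -(mulVf (lt0r_neq0 Zu0)); apply: has_integralZ.
by split; [exact: integrable_expR_tilt|exact: tilt_massE].
Qed.

Lemma has_integral_density_s p : (forall i, 0 < p i) -> has_integral mu0s (density_s p) 1.
Proof.
move=> p0; have Zs0 := sigma_mass_gt0 muE be0 (rate_gt0 p0).
rewrite -(mulVf (lt0r_neq0 Zs0)); apply: has_integralZ.
exact: has_integral_sigma_mass (rate_gt0 p0).
Qed.

Let density_u_ge0 p t : (forall i, 0 < p i) -> 0 <= density_u p t.
Proof.
move=> p0; rewrite mulr_ge0 ?expR_ge0// invr_ge0 ltW//.
by apply: tilt_mass_gt0 => // i; exact/ltW.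
Qed.

Let density_s_ge0 p s : (forall i, 0 < p i) -> 0 <= density_s p s.
Proof.
move=> p0; rewrite mulr_ge0 ?expR_ge0// invr_ge0 ltW//.
exact: (sigma_mass_gt0 muE be0 (rate_gt0 p0)).
Qed.

(** The test function is adapted to the competitor: [p] is the mean precision of [nus], and the
    exponential of [log_density p] has integral 1 against the posterior. *)
Lemma KL_product_ge p (nuu : probability T R) (nus : probability (n.-tuple R) R) :
    (forall i, 0 < p i) -> (forall i, nuu.-integrable setT (EFin \o r i)) ->
    (forall i, has_integral nus (precision i) (p i)) ->
  ((tilt_objective mu0u r a be p + KL_offset)%:E <= KL (nuu \x nus)%E mud)%E.
Proof.
move=> p0 iru hs; have [ipsi psiE] := has_integral_log_density p0 iru hs.
rewrite -psiE; apply: KL_ge => //.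
have me : measurable_fun setT (fun z => (expR (log_density p z))%:E).
  by apply/measurable_EFinP; exact: measurableT_comp.
have e0 z : (0 <= (expR (log_density p z))%:E)%E by rewrite lee_fin expR_ge0.
rewrite (@ge0_integral_density _ _ R mud
  (mu0u \x mu0s : probability _ _)%E _ measurable_density mudE _ me e0).
under eq_integral do rewrite -EFinM expR_log_density//.
have [_ ->] := has_integral_prod (fun t => density_u_ge0 t p0) (fun s => density_s_ge0 s p0)
  (has_integral_density_u p0) (has_integral_density_s p0).
by rewrite mulr1.
Qed.

Lemma KL_product_eq p (nuu : probability T R) (nus : probability (n.-tuple R) R) :
    (forall i, 0 < p i) ->
    (forall A, measurable A -> nuu A = \int[mu0u]_(t in A)
      ((tilt_mass mu0u r p)^-1 * expR (- tilt_exponent r p t))%:E)%E ->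
    (forall A, measurable A -> nus A = \int[mu0s]_(s in A)
      ((sigma_mass al be (sigma_rate p))^-1 * expR (- sigma_potential (sigma_rate p) s))%:E)%E ->
    (forall i, nuu.-integrable setT (EFin \o r i)) ->
    (forall i, has_integral nus (precision i) (p i)) ->
  KL (nuu \x nus)%E mud = (tilt_objective mu0u r a be p + KL_offset)%:E.
Proof.
move=> p0 nuuE nusE iru hs; have [ipsi psiE] := has_integral_log_density p0 iru hs.
rewrite -psiE; apply: KL_density => //.
apply: (@relative_density _ _ R (nuu \x nus)%E mud (mu0u \x mu0s : probability _ _)%E
  _ (log_density p) measurable_density (measurable_log_density p) mudE) => A mA.
under eq_integral do rewrite expR_log_density//.
apply: (product_density _ _ _ _ nuuE nusE) => //.
- apply/measurable_EFinP; apply: measurable_int (has_integral_density_u p0).1.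
- apply/measurable_EFinP; apply: measurable_int (has_integral_density_s p0).1.
- by move=> t; exact: density_u_ge0.
- by move=> s; exact: density_s_ge0.
Qed.

End mean_field.

(** * Admissible measures *)

Section potentials.
Context d (T : measurableType d) (R : realType).
Variables (D : set T) (nu mu : probability T R) (Phi : T -> R).
Hypotheses (mD : measurable D) (mPhi : measurable_fun D Phi).

Lemma measurable_expRN_potential : measurable_fun D (fun x => expR (- Phi x)).
Proof. by apply: measurableT_comp => //; exact: measurableT_comp. Qed.

Hypothesis nuPhi : has_potential D nu mu Phi.

Let Z := fine (\int[mu]_(x in D) (expR (- Phi x))%:E)%E.

Lemma potential_mass_ge0 : 0 <= Z.
Proof. by rewrite fine_ge0//; apply: integral_ge0 => x _; rewrite lee_fin expR_ge0. Qed.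

Lemma potential_mass_neq0 : Z != 0.
Proof.
apply/eqP => Z0; have := nuPhi measurableT; rewrite -/Z Z0 invr0.
under eq_integral do rewrite mul0r.
rewrite integral0 => /eqP; apply/negP.
by rewrite (probability_setT nu) onee_neq0.
Qed.

Let f : T -> R := (fun x => Z^-1 * expR (- Phi x)) \_ D.

Let mf : measurable_fun setT f.
Proof.
apply/(measurable_restrictT _ _).1 => //.
by apply: measurable_funM => //; exact: measurable_expRN_potential.
Qed.

Let f0 x : 0 <= f x.
Proof.
rewrite /f patchE; case: ifP => // _.
by rewrite mulr_ge0 ?expR_ge0// invr_ge0 potential_mass_ge0.
Qed.

Let nuE A : measurable A -> nu A = (\int[mu]_(x in A) (f x)%:E)%E.
Proof.
move=> mA; rewrite nuPhi// integral_mkcondr; apply: eq_integral => x _.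
by rewrite /f !patchE; case: ifP.
Qed.

Lemma potential_conull : nu (~` D) = 0%E.
Proof.
by rewrite nuPhi ?setICl ?integral_set0//; exact: measurableC.
Qed.

(** Transfers conditions such as [Ru2] and [Rs2], which concern the prior, into moments of the
    admissible measure itself. *)
Lemma potential_integrable (h w : T -> R) (K : R) :
    measurable_fun setT h -> measurable_fun D w ->
    (forall x, D x -> 0 <= w x) -> (forall x, D x -> `|h x| <= K * w x) ->
    (\int[mu]_(x in D) (expR (- Phi x) * w x)%:E < +oo)%E ->
  nu.-integrable setT (EFin \o h).
Proof.
move=> mh mw w0 hw wfin; apply/integrableP; split; first exact/measurable_EFinP.
have mw' : measurable_fun D (fun x => expR (- Phi x) * w x).
  by apply: measurable_funM => //; exact: measurable_expRN_potential.
rewrite (ge0_integral_density mf nuE)//; last first.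
  by apply/measurable_EFinP; exact: measurableT_comp.
have -> : (\int[mu]_x (`|(EFin \o h) x| * (f x)%:E) =
    \int[mu]_(x in D) (`|h x| * (Z^-1 * expR (- Phi x)))%:E)%E.
  rewrite [RHS]integral_mkcond; apply: eq_integral => x _ /=.
  by rewrite /f !patchE; case: ifP => // _; rewrite mule0.
pose K' := `|K| * Z^-1.
have K'0 : 0 <= K' by rewrite mulr_ge0// invr_ge0 potential_mass_ge0.
apply: (@le_lt_trans _ _ (K'%:E * \int[mu]_(x in D) `|(expR (- Phi x) * w x)%:E|)%E).
  rewrite -ge0_integralZl//; last first.
    by apply/measurable_EFinP; exact: measurableT_comp.
  apply: ge0_le_integral => //.
  - move=> x Dx; rewrite lee_fin !mulr_ge0 ?expR_ge0// invr_ge0.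
    exact: potential_mass_ge0.
  - apply/measurable_EFinP; apply: measurable_funM.
      by apply: measurableT_comp => //; exact: measurable_funTS.
    by apply: measurable_funM => //; exact: measurable_expRN_potential.
  - apply: emeasurable_funM => //.
    by apply/measurable_EFinP; exact: measurableT_comp.
  - move=> x Dx; rewrite -EFinM lee_fin normrM (ger0_norm (expR_ge0 _)).
    rewrite mulrCA /K' (mulrC `|K|) -mulrA ler_wpM2l//.
      by rewrite invr_ge0 potential_mass_ge0.
    rewrite mulrC mulrCA ler_wpM2l ?expR_ge0//.
    by rewrite (le_trans (hw _ Dx))// -normrM ler_norm.
rewrite lte_mul_pinfty//.
rewrite (eq_integral (fun x => (expR (- Phi x) * w x)%:E))// => x /[!inE] Dx.
by rewrite gee0_abs// lee_fin mulr_ge0 ?expR_ge0// w0.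
Qed.

End potentials.

(** * Elementary bounds by the weights a(eps, sigma) *)

Section weights.
Context {R : realType}.
Implicit Types (x e : R).

(** The power dominates the logarithm for x >= 1, the exponential dominates it for x < 1. *)
Lemma norm_ln_le x e : 0 < x -> 0 < e ->
  `|ln x| <= 2 / e * Num.max (x `^ e) (expR (e / x)).
Proof.
move=> x0 e0; set M := Num.max _ _.
have M1 : x `^ e <= M by rewrite le_max lexx.
have M2 : expR (e / x) <= M by rewrite le_max lexx orbT.
have M0 : 0 <= M by rewrite (le_trans _ M1)// powR_ge0.
suff : e * `|ln x| <= M.
  move=> h; rewrite mulrAC ler_pdivlMr// mulrC (le_trans h)//; lra.
have [x1|x1] := leP 1 x.
  rewrite ger0_norm ?ln_ge0// -ln_powR (le_trans _ M1)//.
  by rewrite ltW// ln_sublinear// powR_gt0.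
rewrite ltr0_norm ?ln_lt0 ?x0// (le_trans _ M2)//.
apply: (@le_trans _ _ (e / x)).
  rewrite ler_wpM2l ?ltW//; have := @ln_sublinear _ x^-1.
  by rewrite lnV ?posrE// invr_gt0 => /(_ x0).
by rewrite (le_trans _ (expR_ge1Dx _))// lerDr.
Qed.

Lemma inv_le_max x e : 0 < x -> 0 < e ->
  x^-1 <= e^-1 * Num.max (x `^ e) (expR (e / x)).
Proof.
move=> x0 e0; rewrite ler_pdivlMl// le_max; apply/orP; right.
by rewrite (le_trans _ (expR_ge1Dx _))// lerDr.
Qed.

(** Near 0 the factor x^(-1/2) of the likelihood is unbounded; it is absorbed by exp((e' - e) / x),
    which is why the exponent has to grow from e to e'. *)
Lemma half_power_le e e' : 0 <= e -> e < e' -> exists2 C, 0 <= C &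
  forall x, 0 < x -> x `^ (- 2^-1) * (x `^ e + expR (e / x)) <=
    C * Num.max (x `^ e') (expR (e' / x)).
Proof.
move=> e0 ee'; have de : 0 < e' - e by rewrite subr_gt0.
have [|C C0 CE] := @powR_le_expR R 2^-1 (e' - e) _ de; first by [].
exists (2 * (1 + C)); first by rewrite mulr_ge0// addr_ge0.
move=> x x0; set M := Num.max _ _.
have M1 : x `^ e' <= M by rewrite le_max lexx.
have M2 : expR (e' / x) <= M by rewrite le_max lexx orbT.
have M0 : 0 <= M by rewrite (le_trans _ M1)// powR_ge0.
have ex : e / x <= e' / x by rewrite ler_pM2r ?invr_gt0// ltW.
have [x1|/ltW x1] := leP 1 x.
  have h1 : x `^ (- 2^-1) <= 1 by rewrite -[leRHS](powRr0 x) ler_powR// oppr_le0.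
  have h2 : x `^ e <= M by rewrite (le_trans _ M1)// ler_powR// ltW.
  have h3 : expR (e / x) <= M by rewrite (le_trans _ M2)// ler_expR.
  apply: (@le_trans _ _ (1 * (M + M))).
    by rewrite ler_pM ?powR_ge0 ?addr_ge0 ?powR_ge0 ?expR_ge0 ?lerD.
  have := mulr_ge0 C0 M0; lra.
have h1 : x `^ e <= expR (e / x).
  have x01 : 0 < x <= 1 by rewrite x0.
  rewrite (@le_trans _ _ 1)//.
    by rewrite -[leRHS](powRr0 x) ger_powR.
  by rewrite -[leLHS]expR0 ler_expR divr_ge0 ?(ltW x0).
have h2 : x `^ (- 2^-1) * expR (e / x) <= C * M.
  have -> : x `^ (- 2^-1) = x^-1 `^ 2^-1.
    by rewrite -[x^-1]powR_inv1 ?ltW// -powRrM mulN1r.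
  apply: (@le_trans _ _ (C * expR ((e' - e) * x^-1) * expR (e / x))).
    by rewrite ler_wpM2r ?expR_ge0// CE// invr_gt0.
  rewrite -mulrA -expRD ler_wpM2l// (_ : _ + _ = e' / x)//; ring.
have h3 : x `^ (- 2^-1) * (x `^ e + expR (e / x)) <= x `^ (- 2^-1) * (2 * expR (e / x)).
  by rewrite ler_wpM2l ?powR_ge0//; lra.
rewrite (le_trans h3)// mulrCA; lra.
Qed.

Lemma le_aweight n (s : n.-tuple R) e i :
  Num.max (tnth s i `^ e) (expR (e / tnth s i)) <= aweight e s.
Proof.
rewrite /aweight (bigD1 i)//= lerDl; apply: sumr_ge0 => j _; by rewrite le_max powR_ge0.
Qed.

Lemma aweight_ge0 n (s : n.-tuple R) e : 0 <= aweight e s.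
Proof. by apply: sumr_ge0 => i _; rewrite le_max powR_ge0. Qed.

Lemma measurable_aweight n e : measurable_fun setT (fun s : n.-tuple R => aweight e s).
Proof.
apply: measurable_sum => i; apply: measurable_maxr.
  by apply: (measurableT_comp (measurable_powR e)); exact: measurable_tnth.
apply: measurableT_comp => //; apply: measurable_funM => //.
by apply: (measurableT_comp (@measurable_inv R)); exact: measurable_tnth.
Qed.

End weights.

(** * Admissibility and moments on the side of sigma *)

Section admissible_precision.
Context {R : realType} {n : nat}.
Variables (al be : 'I_n -> R) (mu : probability (n.-tuple R) R) (eps0 : R).
Hypotheses (muE : is_IG_product al be mu) (al0 : forall i, 0 < al i)
  (be0 : forall i, 0 < be i) (eps0_gt0 : 0 < eps0)
  (aw_fin : forall eps, 0 < eps < eps0 ->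
    (\int[mu]_(s in orthant n) (aweight eps s)%:E < +oo)%E).

Lemma orthant_conull : mu (~` orthant n) = 0%E.
Proof.
rewrite probability_setC; last exact: measurable_orthant.
by rewrite (marginal_orthant muE) subee.
Qed.

Lemma ge0_integral_orthant (f : n.-tuple R -> R) :
    measurable_fun setT f -> (forall s, 0 <= f s) ->
  (\int[mu]_(s in orthant n) (f s)%:E = \int[mu]_s (f s)%:E)%E.
Proof.
move=> mf f0; rewrite -[X in integral _ X](setTI (orthant n)).
by rewrite ge0_integral_conull//; [exact: measurable_orthant|exact: orthant_conull].
Qed.

Lemma Rs1_sigma_potential c : (forall i, 0 <= c i) -> @Rs1 R n (sigma_potential c).
Proof.
move=> c0 N N0; pose B := \sum_(i < n) (2^-1 * N%:R + c i * N%:R) : R.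
apply: (@le_lt_trans _ _ B%:E); last exact: ltry.
apply: ge_ereal_sup => _ [s sN <-]; rewrite lee_fin; apply: ler_sum => i _.
have /andP[s1 s2] := sN i.
have Nr0 : (0 : R) < N%:R by rewrite ltr0n.
have si0 : 0 < tnth s i by rewrite (lt_le_trans _ s1)// invr_gt0.
rewrite lerD//.
  by rewrite ler_wpM2l// (le_trans (ltW (ln_sublinear si0))).
rewrite ler_wpM2l// /precision gtr0_norm//.
by rewrite -[leRHS]invrK lef_pV2 ?posrE ?invr_gt0.
Qed.

Let h e (x : R) := x `^ e + expR (e / x).

Let mh e : measurable_fun setT (h e).
Proof.
apply: measurable_funD; first exact: measurable_powR.
apply: measurableT_comp => //; apply: measurable_funM => //.
exact: measurable_inv.
Qed.

Let h0 e x : 0 <= h e x.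
Proof. by rewrite addr_ge0 ?powR_ge0 ?expR_ge0. Qed.

Let weighted_factor_lty c e k : 0 <= c k -> 0 <= e < eps0 ->
  (\int[mu]_s (sigma_factor (c k) (tnth s k) * h e (tnth s k))%:E < +oo)%E.
Proof.
move=> ck0 /andP[e0 elt].
(* The midpoint leaves room on both sides: [half_power_le] needs e < e', integrability of the prior
   weight needs e' < eps0. *)
pose e' := (e + eps0) / 2.
have ee' : e < e' by rewrite /e'; lra.
have e'0 : 0 < e' < eps0 by apply/andP; rewrite /e'; split; lra.
have [C C0 CE] := half_power_le e0 ee'.
have mfh : measurable_fun setT (fun s : n.-tuple R => sigma_factor (c k) (tnth s k) *
  h e (tnth s k)).
  apply: measurable_funM.
    by apply: (measurableT_comp (measurable_sigma_factor (c k))); exact: measurable_tnth.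
  by apply: (measurableT_comp (mh e)); exact: measurable_tnth.
rewrite -ge0_integral_orthant//; last by move=> s; rewrite mulr_ge0 ?expR_ge0.
apply: (@le_lt_trans _ _ (C%:E * \int[mu]_(s in orthant n) (aweight e' s)%:E)%E); last first.
  by rewrite lte_mul_pinfty// aw_fin.
have mo := @measurable_orthant R n.
have maw : measurable_fun (orthant n) (fun s : n.-tuple R => (aweight e' s)%:E).
  by apply/measurable_EFinP; apply: measurable_funTS; exact: measurable_aweight.
rewrite -ge0_integralZl//; last by move=> s _; rewrite lee_fin aweight_ge0.
apply: ge0_le_integral => //.
- by move=> s _; rewrite lee_fin mulr_ge0 ?expR_ge0.
- by apply/measurable_EFinP; exact: measurable_funTS.
- exact: emeasurable_funM.
- move=> s so; have sk0 := so k; rewrite -EFinM lee_fin sigma_factorE//.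
  apply: (@le_trans _ _ (tnth s k `^ (- 2^-1) * h e (tnth s k))).
    rewrite ler_wpM2r// ler_piMr ?powR_ge0// expR_le1 mulNr oppr_le0.
    by rewrite divr_ge0// ltW.
  by rewrite (le_trans (CE _ sk0))// ler_wpM2l// le_aweight.
Qed.

(** The weight is a sum of functions of one coordinate. Bounding each maximum by a sum splits the
    integral into integrals of products over the coordinates, in each of which at most one factor
    carries a weight. *)
Lemma Rs2_sigma_potential c : (forall i, 0 <= c i) ->
  Rs2 eps0 mu (sigma_potential c).
Proof.
move=> c0 e e01.
have bc i : 0 < be i + c i by rewrite ltr_wpDr.
have mo := @measurable_orthant R n.
have mek : measurable_fun setT (fun s : n.-tuple R => expR (- sigma_potential c s)).
  apply: measurableT_comp => //; apply: measurableT_comp => //.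
  exact: measurable_sigma_potential.
have mhk k : measurable_fun setT (fun s : n.-tuple R => h e (tnth s k)).
  by apply: (measurableT_comp (mh e)); exact: measurable_tnth.
have prod_lty k : (\int[mu]_s (expR (- sigma_potential c s) * h e (tnth s k))%:E < +oo)%E.
  pose g i x := sigma_factor (c i) x * (if i == k then h e x else 1).
  have E s : expR (- sigma_potential c s) * h e (tnth s k) = \prod_i g i (tnth s i).
    rewrite expRN_sigma_potential /g big_split/= -big_mkcond big_pred1_eq//.
  under eq_integral do rewrite E.
  have g0 i x : 0 <= g i x by rewrite mulr_ge0 ?expR_ge0//; case: eqP.
  have gfin i : (\int[mu]_s (g i (tnth s i))%:E < +oo)%E.
    rewrite /g; case: eqP => [_|_]; first exact: weighted_factor_lty.
    under eq_integral do rewrite mulr1.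
    by rewrite (integral_sigma_factor muE)// ltry.
  rewrite (ge0_integral_prod muE (g := g))//; last first.
    move=> i; apply: measurable_funM; first exact: measurable_sigma_factor.
    by case: eqP => // _; exact: mh.
  have int0 i : (0 <= \int[mu]_s (g i (tnth s i))%:E)%E.
    by apply: integral_ge0 => s _; rewrite lee_fin.
  rewrite -ge0_fin_numE ?prode_ge0//.
  by apply: prode_fin_num => i _; rewrite ge0_fin_numE.
apply: (@le_lt_trans _ _ (\int[mu]_(s in orthant n)
    (expR (- sigma_potential c s) + \sum_k expR (- sigma_potential c s) * h e (tnth s k))%:E)%E).
  apply: ge0_le_integral => //.
  - by move=> s _; rewrite lee_fin mulr_ge0 ?expR_ge0// le_max ler01.
  - apply/measurable_EFinP; apply: measurable_funTS; apply: measurable_funM => //.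
    by apply: measurable_maxr => //; exact: measurable_aweight.
  - apply/measurable_EFinP; apply: measurable_funTS; apply: measurable_funD => //.
    by apply: measurable_sum => k; exact: measurable_funM.
  - move=> s so; rewrite lee_fin -[X in _ <= X + _]mulr1 -mulr_sumr -mulrDr.
    rewrite ler_wpM2l ?expR_ge0// ge_max lerDl sumr_ge0//=.
    rewrite (@le_trans _ _ (\sum_k h e (tnth s k)))// ?lerDr//.
    apply: ler_sum => k _; rewrite ge_max /h.
    by rewrite lerDl lerDr powR_ge0 expR_ge0.
rewrite ge0_integral_orthant//; last 2 first.
- apply: measurable_funD => //.
  by apply: measurable_sum => k; exact: measurable_funM.
- by move=> s; rewrite addr_ge0 ?expR_ge0// sumr_ge0// => k _; rewrite mulr_ge0 ?expR_ge0.
under eq_integral do rewrite EFinD -sumEFin.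
have mS : measurable_fun setT (fun s : n.-tuple R =>
    \sum_k (expR (- sigma_potential c s) * h e (tnth s k))%:E)%E.
  by apply: emeasurable_sum => k; apply/measurable_EFinP; exact: measurable_funM.
have S0 (s : n.-tuple R) : (0 <= \sum_k (expR (- sigma_potential c s) * h e (tnth s k))%:E)%E.
  by apply: sume_ge0 => k _; rewrite lee_fin mulr_ge0 ?expR_ge0.
rewrite ge0_integralD//; last exact/measurable_EFinP.
rewrite lte_add_pinfty//.
  by have [_ ->] := has_integral_sigma_mass muE be0 bc; exact: ltry.
rewrite ge0_integral_sum//; last 2 first.
- by move=> k; apply/measurable_EFinP; exact: measurable_funM.
- by move=> k s _; rewrite lee_fin mulr_ge0 ?expR_ge0.
by apply: lte_sum_pinfty => k _; exact: prod_lty.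
Qed.

Lemma As_integrable (nus : probability (n.-tuple R) R) (e K : R) (f : n.-tuple R -> R) :
    As eps0 mu nus -> 0 < e < eps0 -> measurable_fun setT f ->
    (forall s, orthant n s -> `|f s| <= K * aweight e s) ->
  nus.-integrable setT (EFin \o f).
Proof.
move=> [_ [Phi [mPhi _ R2 hPhi]]] /andP[e0 elt] mf fK.
apply: (potential_integrable (@measurable_orthant R n) mPhi hPhi mf
  (w := fun s => Num.max 1 (aweight e s)) (K := `|K|)).
- apply: measurable_funTS; apply: measurable_maxr => //; exact: measurable_aweight.
- by move=> s _; rewrite le_max ler01.
- move=> s so; rewrite (le_trans (fK _ so))// (le_trans (ler_norm _))// normrM.
  by rewrite ler_wpM2l// ger0_norm ?aweight_ge0// le_max lexx orbT.
- by apply: R2; rewrite ltW.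
Qed.

Lemma As_integrable_precision (nus : probability (n.-tuple R) R) i :
  As eps0 mu nus -> nus.-integrable setT (EFin \o precision i).
Proof.
move=> nusA; have e2 : 0 < eps0 / 2 < eps0 by rewrite divr_gt0//= ltr_pdivrMr// ltr_pMr// ltr1n.
have /andP[e20 _] := e2.
apply: (As_integrable nusA e2 (K := (eps0 / 2)^-1)); first exact: measurable_precision.
move=> s so; rewrite /precision gtr0_norm ?invr_gt0 ?normr_gt0 ?gt_eqF// gtr0_norm//.
rewrite (le_trans (inv_le_max (so i) e20))// ler_wpM2l ?invr_ge0 ?(ltW e20)//.
exact: le_aweight.
Qed.

Lemma As_integrable_ln (nus : probability (n.-tuple R) R) i :
  As eps0 mu nus -> nus.-integrable setT (fun s => (ln (tnth s i))%:E).
Proof.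
move=> nusA; have e2 : 0 < eps0 / 2 < eps0 by rewrite divr_gt0//= ltr_pdivrMr// ltr_pMr// ltr1n.
have /andP[e20 _] := e2.
apply: (As_integrable nusA e2 (K := 2 / (eps0 / 2))); first exact: measurable_ln_tnth.
move=> s so; rewrite (le_trans (norm_ln_le (so i) e20))// ler_wpM2l//.
  by rewrite divr_ge0// ltW.
exact: le_aweight.
Qed.

Lemma As_conull (nus : probability (n.-tuple R) R) :
  As eps0 mu nus -> nus (~` orthant n) = 0%E.
Proof.
move=> [_ [Phi [mPhi _ _ hPhi]]].
exact: (potential_conull (@measurable_orthant R n) hPhi).
Qed.

(** Makes the mean precision of a competitor an argument at which the minimality of the objective
    can be used. *)
Lemma As_precision_gt0 (nus : probability (n.-tuple R) R) i : As eps0 mu nus ->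
  0 < fine (\int[nus]_s (precision i s)%:E)%E.
Proof.
move=> nusA; have mo := @measurable_orthant R n.
have fin := integrable_fin_num measurableT (As_integrable_precision i nusA).
rewrite -lte_fin fineK// lt_neqAle; apply/andP; split; last first.
  by apply: integral_ge0 => s _; rewrite lee_fin invr_ge0.
apply/eqP => /esym I0.
have : nus (orthant n) = 0%E.
  apply: (@gt0_integral0_null _ _ _ nus (orthant n) (precision i)) => //.
  - by apply: measurable_funTS; exact: measurable_precision.
  - by move=> s so; rewrite invr_gt0 normr_gt0 gt_eqF.
  - rewrite -[X in integral _ X](setTI (orthant n)) ge0_integral_conull//.
    + exact: As_conull.
    + exact: measurable_precision.
    + by move=> s; rewrite invr_ge0.
move=> o0; have := probability_setC nus mo.
by rewrite As_conull// o0 sube0 => /eqP; rewrite eq_sym onee_eq0.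
Qed.

End admissible_precision.

(** * The observation operator *)

Section residual.
Context {R : realType} {U : hilbertType R} {n : nat}.
Variables (H : {linear U -> 'cV[R]_n}) (d : 'cV[R]_n) (M : R).
Hypothesis HM : forall u, enorm (H u) <= M * `|u|.

Definition residual (i : 'I_n) (u : borel U) : R := (d i 0 - H (u : U) i 0) ^+ 2.

Lemma residual_ge0 i u : 0 <= residual i u.
Proof. exact: sqr_ge0. Qed.

Lemma norm_coord_le_enorm (x : 'cV[R]_n) i : `|x i 0| <= enorm x.
Proof.
rewrite -sqrtr_sqr ler_wsqrtr// (bigD1 i)//= lerDl.
by apply: sumr_ge0 => k _; exact: sqr_ge0.
Qed.

Lemma norm_observation_le i (u : U) : `|H u i 0| <= `|M| * `|u|.
Proof.
rewrite (le_trans (norm_coord_le_enorm _ i))// (le_trans (HM u))//.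
by rewrite ler_wpM2r// ler_norm.
Qed.

Lemma continuous_observation i : continuous (fun u : U => H u i 0 : R).
Proof.
move=> u; apply/cvgrPdist_lt => e e0.
have cB : `|M| * `|u - w| @[w --> u] --> (0 : R).
  rewrite (_ : 0 = `|M| * `|u - u|); last by rewrite subrr normr0 mulr0.
  apply: cvgM; first exact: cvg_cst.
  by apply: cvg_norm; apply: cvgB; [exact: cvg_cst|exact: cvg_id].
move/cvgrPdist_lt: cB => /(_ e e0); apply: filterS => w.
rewrite sub0r normrN => /(le_lt_trans (ler_norm _)); apply: le_lt_trans.
have -> : H u i 0 - H w i 0 = H (u - w) i 0 by rewrite linearB !mxE.
exact: norm_observation_le.
Qed.

Lemma measurable_residual i : measurable_fun setT (residual i).
Proof.
apply: measurable_funX; apply: measurable_funB => //.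
apply: measurable_continuous_borel; exact: continuous_observation.
Qed.

Lemma measurable_sqr_norm : measurable_fun [set: borel U] (fun u : borel U => `|u : U| ^+ 2 : R).
Proof.
apply: measurable_funX; apply: measurable_continuous_borel.
exact: norm_continuous.
Qed.

Lemma residual_le i (u : U) :
  residual i u <= 2 * (d i 0 ^+ 2 + M ^+ 2) * Num.max 1 (`|u| ^+ 2).
Proof.
set W := Num.max _ _.
have W1 : 1 <= W by rewrite le_max lexx.
have Wu : `|u| ^+ 2 <= W by rewrite le_max lexx orbT.
have h1 : H u i 0 ^+ 2 <= M ^+ 2 * W.
  apply: (@le_trans _ _ (M ^+ 2 * `|u| ^+ 2)); last by rewrite ler_wpM2l ?sqr_ge0.
  rewrite -real_normK ?num_real// -(real_normK (num_real M)) -exprMn.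
  by rewrite ler_pXn2r ?nnegrE ?mulr_ge0// norm_observation_le.
have h2 : d i 0 ^+ 2 <= d i 0 ^+ 2 * W by rewrite ler_peMr ?sqr_ge0.
(* By (d - h)^2 = 2 d^2 + 2 h^2 - (d + h)^2. *)
rewrite /residual; have := sqr_ge0 (d i 0 + H u i 0); lra.
Qed.

Lemma potentialE (u : U) (s : n.-tuple R) : orthant n s ->
  potential H d u s = joint_potential residual (u : borel U, s).
Proof.
move=> so; rewrite /potential /Sigma_norm /enorm sqr_sqrtr; last first.
  by apply: sumr_ge0 => i _; exact: sqr_ge0.
have -> : ln (\det (Sigma s)) = \sum_i ln (tnth s i).
  rewrite det_diag; apply: expR_inj.
  rewrite expR_sum lnK ?posrE; last by apply: prodr_gt0 => i _; rewrite mxE; exact: so.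
  by apply: eq_bigr => i _; rewrite mxE lnK// posrE; exact: so.
rewrite !mulr_sumr -big_split/=; apply: eq_bigr => i _; congr (_ * _ + _).
rewrite mul_diag_mx !mxE exprMn exprVn sqr_sqrtr ?(ltW (so i))// mulrC.
by rewrite /precision gtr0_norm ?(so i).
Qed.

End residual.

Lemma Au_integrable (R : realType) (U Z : hilbertType R) (j : Z -> U)
    (mu nu : probability (borel U) R) (f : borel U -> R) (K : R) :
    Au j mu nu -> measurable_fun setT f ->
    (forall u, `|f u| <= K * Num.max 1 (`|u : U| ^+ 2)) ->
  nu.-integrable setT (EFin \o f).
Proof.
move=> [_ [Phi [mPhi _ R2 hPhi]]] mf fK.
apply: (potential_integrable measurableT mPhi hPhi mf
  (w := fun u => Num.max 1 (`|u : U| ^+ 2)) (K := K)) => //.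
- by apply: measurable_maxr => //; exact: measurable_sqr_norm.
Qed.

(** * The minimising pair and its potentials *)

Lemma density_equivalent d (T : measurableType d) (R : realType)
    (nu mu : probability T R) (D : set T) (f : T -> R) :
    measurable D -> mu (~` D) = 0%E ->
    measurable_fun setT f -> (forall x, 0 < f x) ->
    (forall A, measurable A -> nu A = \int[mu]_(x in A) (f x)%:E)%E ->
  equivalent_measures nu mu.
Proof.
move=> mD D0 mf f0 nuE; split; first exact: density_dominates mf nuE.
apply/null_content_dominatesP => A mA nuA0.
apply: (@gt0_integral0_null _ _ _ mu A f) => //; first exact: measurable_funTS.
by rewrite -nuE.
Qed.

Theorem theorem2 (R : realType) (U : hilbertType R) (Nd : nat)
  (H : {linear U -> 'cV[R]_Nd}) (d : 'cV[R]_Nd)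
  (ubar0 : U) (C0 : {linear U -> U}) (mu0u : probability (borel U) R)
  (alpha beta : 'I_Nd -> R) (mu0s : probability (Nd.-tuple R) R)
  (Z : hilbertType R) (j : {linear Z -> U}) (eps0 : R)
  (mud : probability (borel U * Nd.-tuple R)%type R) :
  separable (U := U) ->
  (0 < Nd)%N ->
  (exists M : R, forall u, enorm (H u) <= M * `|u|) ->
  bounded_op C0 -> symmetric_op C0 -> posdef_op C0 -> trace_class C0 ->
  gaussian_measure ubar0 C0 mu0u ->
  (forall i, 1 < alpha i /\ 0 < beta i) ->
  is_IG_product alpha beta mu0s ->
  injective j -> bounded_op j ->
  ereal_sup [set mu0u (TNu j N) | N in [set N | (0 < N)%N]] = 1%E ->
  0 < eps0 ->
  (forall eps, 0 < eps < eps0 ->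
    (\int[mu0s]_(s in orthant Nd) (aweight eps s)%:E < +oo)%E) ->
  has_potential (setT `*` orthant Nd) mud (mu0u \x mu0s)%E
    (fun us => potential H d us.1 us.2) ->
  exists (nuu : probability (borel U) R) (nus : probability (Nd.-tuple R) R),
    [/\ Au j mu0u nuu, As eps0 mu0s nus,
      (forall (nuu' : probability (borel U) R)
              (nus' : probability (Nd.-tuple R) R),
        Au j mu0u nuu' -> As eps0 mu0s nus' ->
        (KL (nuu \x nus) mud <= KL (nuu' \x nus') mud)%E) &
      exists (Phiu : U -> R) (Phis : Nd.-tuple R -> R) (cu cs : R),
        [/\ prop_potential (setT `*` orthant Nd) (nuu \x nus)%E
              (mu0u \x mu0s)%E (fun us => Phiu us.1 + Phis us.2),
          (forall u, (Phiu u)%:E =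
            \int[nus]_(s in orthant Nd) (potential H d u s)%:E + cu%:E)%E,
          (forall s, orthant Nd s -> (Phis s)%:E =
            \int[nuu]_u (potential H d u s)%:E + cs%:E)%E,
          prop_potential setT nuu mu0u Phiu &
          prop_potential (orthant Nd) nus mu0s Phis]].
Proof.
move=> _ _ [M HM] _ _ pC trC gauss ab muE _ [Mj jM] _ e0 awfin mudP.
have al0 i : 0 < alpha i by have [al1 _] := ab i; exact: lt_trans al1.
have be0 i : 0 < beta i by have [_] := ab i.
pose r := residual H d; pose a := posterior_shape alpha.
have a0 i : 0 < a i by rewrite /a /posterior_shape addr_gt0.
have mr i : measurable_fun setT (r i) by exact: (measurable_residual d HM).
have r0 i u : 0 <= r i u by exact: residual_ge0.
have r_le i u : `|r i u| <= 2 * (d i 0 ^+ 2 + M ^+ 2) * Num.max 1 (`|u : U| ^+ 2).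
  by rewrite ger0_norm// (residual_le d HM).
have mn2 := @measurable_sqr_norm R U.
have isq : mu0u.-integrable setT (fun u => (1 + `|u : U| ^+ 2)%:E).
  have := has_integralD (has_integral_cst mu0u 1).
  have hn : mu0u.-integrable setT (EFin \o (fun u : borel U => `|u : U| ^+ 2)).
    apply/integrableP; split; first exact/measurable_EFinP.
    under eq_integral do rewrite gee0_abs ?lee_fin ?sqr_ge0//.
    exact: gaussian_second_moment pC trC gauss.
  by move=> /(_ _ _ (integrable_has_integral hn)) [].
have le_n2 (u : U) : Num.max 1 (`|u| ^+ 2) <= 1 + `|u| ^+ 2.
  by rewrite ge_max lerDl sqr_ge0/= lerDr.
have ir i : mu0u.-integrable setT (EFin \o r i).
  have iK := integrableZl measurableT (2 * (d i 0 ^+ 2 + M ^+ 2)) isq.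
  apply: (le_integrable measurableT _ _ iK); first exact/measurable_EFinP.
  move=> u _ /=; rewrite lee_fin (le_trans (r_le i u))// ger0_norm; last first.
    by rewrite !mulr_ge0 ?addr_ge0 ?sqr_ge0.
  by rewrite ler_wpM2l// mulr_ge0// addr_ge0 ?sqr_ge0.
pose D := [set: borel U] `*` (orthant Nd : set (Nd.-tuple R)).
have mo := @measurable_orthant R Nd.
have mD : measurable D by exact: measurableX.
have D0 : (mu0u \x mu0s)%E (~` D) = 0%E.
  have -> : ~` D = [set: borel U] `*` ~` (orthant Nd : set (Nd.-tuple R)).
    apply/seteqP; split=> -[u s]; last by move=> [_ h] [].
    by move=> h; split=> // so; apply: h; split.
  rewrite product_measure1E//; last exact: measurableC.
  by rewrite [X in (_ * X)%E](orthant_conull muE) mule0.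
have mP := measurable_joint_potential mr.
have PE z : D z -> potential H d z.1 z.2 = joint_potential r z.
  by case: z => u s [_ so]; exact: potentialE.
have mpot : measurable_fun D (fun z => potential H d z.1 z.2).
  apply: (eq_measurable_fun (joint_potential r)); last exact: measurable_funTS.
  by move=> z /set_mem /PE ->.
pose Zd := fine (\int[mu0u \x mu0s]_(z in D) (expR (- potential H d z.1 z.2))%:E)%E.
have Zd_gt0 : 0 < Zd.
  rewrite lt_neqAle eq_sym (potential_mass_neq0 mudP)/=.
  exact: potential_mass_ge0.
have mudE A : measurable A ->
    mud A = (\int[mu0u \x mu0s]_(z in A) (Zd^-1 * expR (- joint_potential r z))%:E)%E.
  move=> mA; rewrite mudP// -/D -/Zd.
  rewrite (eq_integral (fun z => (Zd^-1 * expR (- joint_potential r z))%:E)); last first.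
    by move=> z /set_mem [_ Dz]; rewrite PE.
  apply: ge0_integral_conull => //.
    by apply: measurable_funM => //; apply: measurableT_comp => //; exact: measurableT_comp.
  by move=> z; rewrite mulr_ge0 ?expR_ge0// invr_ge0 ltW.
have [p p0 pmin] := tilt_objective_min mr r0 ir a0 be0.
have p0' i : 0 <= p i by exact/ltW.
have stat := tilt_objective_stationary mr r0 ir a0 be0 p0 pmin.
pose c := sigma_rate alpha beta p.
have bc i : beta i + c i = a i / p i by rewrite /c /sigma_rate addrC subrK.
have bc0 i : 0 < beta i + c i by rewrite bc divr_gt0.
have Zu0 := tilt_mass_gt0 mu0u mr r0 p0'.
have Zs0 := sigma_mass_gt0 muE be0 bc0.
(* By stationarity [2 * c i] is a mean of the nonnegative r_i under the tilted prior. The conditions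
   [Rs1] and [Rs2] will be checked through this sign. *)
have c0 i : 0 <= c i.
  have : 0 <= tilt_mass mu0u r p * (2 * c i).
    rewrite -lee_fin -stat; apply: integral_ge0 => u _.
    by rewrite lee_fin mulr_ge0 ?expR_ge0.
  by rewrite pmulr_rge0// pmulr_rge0.
pose fu u := (tilt_mass mu0u r p)^-1 * expR (- tilt_exponent r p u).
pose fs s := (sigma_mass alpha beta c)^-1 * expR (- sigma_potential c s).
have fu_gt0 u : 0 < fu u by rewrite mulr_gt0 ?invr_gt0 ?expR_gt0.
have fs_gt0 s : 0 < fs s by rewrite mulr_gt0 ?invr_gt0 ?expR_gt0.
have hfu : has_integral mu0u fu 1 := has_integral_density_u mu0u mr r0 p0.
have hfs : has_integral mu0s fs 1 := has_integral_density_s muE al0 be0 p0.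
have mfu : measurable_fun setT fu by apply/measurable_EFinP; exact: measurable_int hfu.1.
have mfs : measurable_fun setT fs by apply/measurable_EFinP; exact: measurable_int hfs.1.
have [nuu nuuE] := density_probability mfu (fun u => ltW (fu_gt0 u)) hfu.2.
have [nus nusE] := density_probability mfs (fun s => ltW (fs_gt0 s)) hfs.2.
have so0 := orthant_conull muE.
(* This half of the fixed point equations is where the minimality of [p] enters. *)
have nuu_r i : has_integral nuu (r i) (2 * c i).
  apply: (has_integral_density mfu (fun u => ltW (fu_gt0 u)) nuuE (mr i)).
  have h := conj (integrable_tilt_moment mr r0 ir i p0') (stat i).
  rewrite -[2 * c i](mulKf (lt0r_neq0 Zu0)).
  apply: eq_has_integral (has_integralZ (tilt_mass mu0u r p)^-1 h) => u.
  by rewrite /fu; ring.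
(* The other half holds for any p with positive entries, by the choice of the rate. *)
have nus_p i : has_integral nus (precision i) (p i).
  apply: (has_integral_density mfs (fun s => ltW (fs_gt0 s)) nusE (measurable_precision i)).
  have h := has_integral_precision muE al0 be0 i bc0.
  have -> : p i = (sigma_mass alpha beta c)^-1 *
      (sigma_mass alpha beta c * (a i / (beta i + c i))).
    by rewrite bc; field; rewrite !gt_eqF.
  by apply: eq_has_integral (has_integralZ (sigma_mass alpha beta c)^-1 h) => s; rewrite /fs; ring.
have mtilt := measurable_tilt_exponent mr p.
have tilt0 u : 0 <= tilt_exponent r p u by exact: tilt_exponent_ge0.
have nuuP : has_potential setT nuu mu0u (tilt_exponent r p).
  by move=> A mA; rewrite setIT; exact: nuuE.
have msig := measurable_sigma_potential c.
have nusE' A : measurable A -> nus A = (\int[mu0s]_(s in A `&` orthant Nd) (fs s)%:E)%E.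
  move=> mA; rewrite ge0_integral_conull//; first exact: nusE.
  by move=> s; exact/ltW.
have nusP : has_potential (orthant Nd) nus mu0s (sigma_potential c).
  move=> A mA /=; rewrite (ge0_integral_orthant muE); last 2 first.
  - by apply: measurableT_comp => //; exact: measurableT_comp.
  - by move=> s; exact: expR_ge0.
  by rewrite (has_integral_sigma_mass muE be0 bc0).2; exact: nusE'.
have AuN : Au j mu0u nuu.
  split; first by apply: (density_equivalent (D := setT) _ _ mfu fu_gt0 nuuE);
    rewrite ?setCT ?measure0.
  exists (tilt_exponent r p); split => //.
  - move=> N N0.
    (* The embedding maps the ball of radius N into the ball of radius |Mj| N, on which the
       quadratic bound on the residuals is uniform. *)
    pose W : R := Num.max 1 ((`|Mj| * N%:R) ^+ 2).
    pose B : R := 2^-1 * \sum_i p i * (2 * (d i 0 ^+ 2 + M ^+ 2) * W).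
    apply: (@le_lt_trans _ _ B%:E); last exact: ltry.
    apply: ge_ereal_sup => _ [_ [z /= /andP[_ zN] <-] <-]; rewrite lee_fin.
    rewrite ler_wpM2l// ler_sum// => i _; rewrite ler_wpM2l//.
    rewrite (le_trans (ler_norm _))// (le_trans (r_le i _))// ler_wpM2l//.
      by rewrite mulr_ge0// addr_ge0 ?sqr_ge0.
    rewrite ge_max le_max lexx/= le_max; apply/orP; right.
    rewrite ler_pXn2r ?nnegrE ?mulr_ge0// (le_trans (jM z))//.
    apply: (@le_trans _ _ (`|Mj| * `|z|)); last by rewrite ler_wpM2l.
    by rewrite ler_wpM2r// ler_norm.
  - rewrite /Ru2/=; apply: le_lt_trans (integrable_lty measurableT isq).
    apply: ge0_le_integral => //.
    + apply/measurable_EFinP; apply: measurable_funM.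
        by apply: measurableT_comp => //; exact: measurableT_comp.
      exact: measurable_maxr.
    + exact: measurable_int isq.
    + move=> u _; rewrite lee_fin (le_trans _ (le_n2 u))// ler_piMl ?le_max ?ler01//.
      by rewrite expR_le1 oppr_le0.
have AsN : As eps0 mu0s nus.
  split; first exact: density_equivalent mo so0 mfs fs_gt0 nusE.
  exists (sigma_potential c); split => //.
  - exact: measurable_funTS.
  - exact: Rs1_sigma_potential.
  - exact: (Rs2_sigma_potential muE be0 awfin).
exists nuu, nus; split => //.
- move=> nuu' nus' Au' As'.
  have iru i : nuu'.-integrable setT (EFin \o r i) by exact: Au_integrable Au' (mr i) (r_le i).
  pose p' i := fine (\int[nus']_s (precision i s)%:E)%E.
  have p'0 i : 0 < p' i by exact: As_precision_gt0 As'.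
  have hp' i : has_integral nus' (precision i) (p' i).
    by apply: integrable_has_integral; exact: As_integrable_precision As'.
  (* The lower bound is taken at the competitor's p', the exact value at p; minimality of p links
     the two. *)
  apply: le_trans (KL_product_ge mr r0 muE al0 be0 Zd_gt0 mudE p'0 iru hp').
  rewrite (KL_product_eq mr r0 muE al0 be0 Zd_gt0 mudE p0 nuuE nusE (fun i => (nuu_r i).1) nus_p).
  by rewrite lee_fin lerD2r pmin.
pose L i := fine (\int[nus]_s (ln (tnth s i))%:E)%E.
have hL i : has_integral nus (fun s => ln (tnth s i)) (L i).
  by apply: integrable_has_integral; exact: As_integrable_ln AsN.
(* The first constant removes the mean of ln det Sigma / 2, which does not depend on u. The second
   is 0 since [sigma_potential] retains its logarithms. *)
exists (tilt_exponent r p), (sigma_potential c), (- \sum_i 2^-1 * L i), 0; split.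
- exists ((tilt_mass mu0u r p)^-1 * (sigma_mass alpha beta c)^-1).
    by rewrite mulr_gt0 ?invr_gt0.
  move=> A mA.
  transitivity (\int[mu0u \x mu0s]_(z in A) (fu z.1 * fs z.2)%:E)%E.
    apply: (product_density mfu mfs _ _ nuuE nusE mA) => [u|s]; exact/ltW.
  rewrite -(ge0_integral_conull mA mD D0); last 2 first.
  - by apply: measurable_funM; exact: measurableT_comp.
  - by move=> z; rewrite mulr_ge0// ltW.
  apply: eq_integral => z _; congr EFin.
  by rewrite opprD expRD /fu /fs; ring.
- move=> u.
  have hP : has_integral nus (fun s => joint_potential r (u, s))
      (\sum_i (2^-1 * (r i u * p i) + 2^-1 * L i)).
    apply: has_integral_sum => i; apply: has_integralD; apply: has_integralZ => //.
    exact: (has_integralZ (r i u) (nus_p i)).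
  have -> : (\int[nus]_(s in orthant Nd) (potential H d u s)%:E =
      \int[nus]_s (joint_potential r (u, s))%:E)%E.
    rewrite (@negligible_integral _ _ _ nus setT (~` orthant Nd))//.
    - rewrite setTD setCK; apply: eq_integral => s /set_mem so.
      by rewrite (potentialE H d u so).
    - exact: measurableC.
    - exact: hP.1.
    - exact: As_conull AsN.
  rewrite hP.2 -EFinD; congr EFin; rewrite big_split/= addrK /tilt_exponent mulr_sumr.
  by apply: eq_bigr => i _; ring.
- move=> s so; rewrite adde0.
  have hP : has_integral nuu (fun u => joint_potential r (u, s))
      (\sum_i (2^-1 * (precision i s * (2 * c i)) + 2^-1 * ln (tnth s i))).
    apply: has_integral_sum => i; apply: has_integralD; last
      exact: (has_integral_cst nuu (2^-1 * ln (tnth s i))).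
    apply: has_integralZ; apply: eq_has_integral (has_integralZ (precision i s) (nuu_r i)).
    by move=> u; rewrite mulrC.
  rewrite (eq_integral (fun u => (joint_potential r (u, s))%:E)); last first.
    by move=> u _; rewrite (potentialE H d u so).
  rewrite hP.2; congr EFin; apply: eq_bigr => i _; by field.
- exists (tilt_mass mu0u r p)^-1; first by rewrite invr_gt0.
  exact: nuuP.
- exists (sigma_mass alpha beta c)^-1; first by rewrite invr_gt0.
  by move=> A mA; exact: nusE'.
Qed.
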